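(* Let $\mathcal M$ be a label of finite type. (a) For every $Q\in\mathcal E(\Theta(\mathcal M))$ there are unique elements $\bar D(Q)\in E(X(\mathcal M),S)$ and $\bar D_+(Q)\in E(X_+(\mathcal M),S)$ such that $$\bar D(Q)(x[\mathcal N])=x[Q(\mathcal N)],\qquad \bar D_+(Q)(x_+[\mathcal N])=x_+[Q(\mathcal N)]\qquad\text{for all }\mathcal N\in\Theta(\mathcal M),$$ with $\bar D(U)$ (and $\bar D_+(U)$) the idempotent $u$ mapping $X(\mathcal M)$ (resp. $X_+(\mathcal M)$) to the fixed point $e=x[\emptyset]=x_+[\emptyset]$. (b) For every $q\in E(X(\mathcal M),S)$ with $q\ne u$ there exists a unique pair $(t,Q)\in\mathbb Z\times\mathcal E(\Theta(\mathcal M))$ such that $q=S^t\bar D(Q)$. For every $q\in E(X_+(\mathcal M),S)$ with $q\ne u$ there exists a unique pair $(t,Q)\in\mathbb Z\times\mathcal E(\Theta(\mathcal M))$ such that $q=S^t\bar D_+(Q)$. (c) For every $\mathbf r\in FIN(\mathbb N)$, $p_{\mathbf r}=\bar D(P_{\mathbf r})\in E(X(\mathcal M),S)$ and $p^+_{\mathbf r}=\bar D_+(P_{\mathbf r})\in E(X_+(\mathcal M),S)$ are continuous, so that $(\mathbf r,z)\mapsto p_{\mathbf r}(z)$ and $(\mathbf r,z)\mapsto p^+_{\mathbf r}(z)$ define continuous semigroup actions $FIN(\mathbb N)\times X(\mathcal M)\to X(\mathcal M)$ and $FIN(\mathbb N)\times X_+(\mathcal M)\to X_+(\mathcal M)$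 respectively.
   Context: Write $\mathbb N=\{1,2,\dots\}$. An $\mathbb N$-vector is a function $\mathbf m:\mathbb N\to\{0,1,2,\dots\}$ with finite support $\mathrm{supp}\,\mathbf m$; $FIN(\mathbb N)$ is the discrete additive monoid of all $\mathbb N$-vectors, with identity $\mathbf 0$ and the pointwise order. A label is a set $\mathcal M\subset FIN(\mathbb N)$ such that $\mathbf 0\le\mathbf m_1\le\mathbf m\in\mathcal M$ implies $\mathbf m_1\in\mathcal M$; it is of finite type if it contains no infinite strictly increasing sequence. $\mathcal{LAB}$ is the compact space of all labels (including $\emptyset$) with the ultrametric $d(\mathcal M_1,\mathcal M_2)=\inf\{2^{-N}:N\ge0,\ \mathcal M_1\cap\mathcal B_N=\mathcal M_2\cap\mathcal B_N\}$, where $\mathcal B_N$ is the set of $\mathbb N$-vectors $\mathbf m$ with $\mathbf m_\ell<N$ for all $\ell$ and $\mathrm{supp}\,\mathbf m\subset[1,N]$. $FIN(\mathbb N)$ acts continuously on $\mathcal{LAB}$ by $P_{\mathbf r}(\mathcal M)=\mathcal M-\mathbf r=\{\mathbf w\in FIN(\mathbb N):\mathbf w+\mathbf r\in\mathcal M\}$. $\Theta(\mathcal M)$ is the closure of $\{\mathcal M-\mathbf r:\mathbf r\in FIN(\mathbb N)\}$, and $\mathcal E(\Theta(\mathcal M))$ is the closure of $\{P_{\mathbf r}|\Theta(\mathcal M):\mathbf r\in FIN(\mathbb N)\}$ in $\Theta(\mathcal M)^{\Theta(\mathcal M)}$ (pointwise convergence); $P_{\mathbf r}$ also denotes its restriction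 to $\Theta(\mathcal M)$. For $\mathcal M\ne FIN(\mathbb N)$ (in particular for finite type), $U\in\mathcal E(\Theta(\mathcal M))$ is the map with constant value $\emptyset$. Fix an odd integer $b\ge5$ and a partition $\{D_\ell:\ell\in\mathbb N\}$ of $\mathbb N$ into infinite sets with $\min D_\ell<\min D_{\ell+1}$. Define $k:\mathbb Z\to\mathbb Z$ by $k(n)=b^{n-1}$ for $n\ge1$, $k(0)=0$, $k(-n)=-k(n)$. $IP(k)$ (resp. $IP_+(k)$) is the set of sums of finite subsets of $k(\mathbb Z)$ (resp. of $k(\{0,1,2,\dots\})$). Each $t\in IP(k)$ has a unique expansion $t=k(j_1)+\dots+k(j_r)$ with $|j_1|>\dots>|j_r|>0$ ($r=0$ for $t=0$); its length vector $\mathbf r(t)\in FIN(\mathbb N)$ is $\mathbf r(t)_\ell=\#\{i:|j_i|\in D_\ell\}$. For a label $\mathcal M$, $A[\mathcal M]=\{t\in IP(k):\mathbf r(t)\in\mathcal M\}$, $A_+[\mathcal M]=A[\mathcal M]\cap IP_+(k)$, and $x[\mathcal M],x_+[\mathcal M]\in\{0,1\}^{\mathbb Z}$ are the characteristic functions of $A[\mathcal M]$ and $A_+[\mathcal M]$. $S$ is the shift $S(x)_t=x_{t+1}$; $X(\mathcal M)$, $X_+(\mathcal M)$ are the orbit closures (under $S^n$, $n\in\mathbb Z$) of $x[\mathcal M]$, $x_+[\mathcal M]$. For a closed shift-invariant $X$, the enveloping semigroup $E(X,S)$ is the closure of $\{S^n|X:n\in\mathbb Z\}$ in $X^X$ (pointwise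 convergence). *)

(* Defs.v *)
From HB Require Import structures.
From mathcomp Require Import all_boot all_order all_algebra.
From mathcomp Require Import finmap.
From mathcomp Require Import all_classical all_reals all_analysis.
From mathcomp Require Import Rstruct.
Set Implicit Arguments.
Unset Strict Implicit.
Unset Printing Implicit Defensive.
Import Order.TTheory GRing.Theory Num.Theory.
Local Open Scope classical_set_scope.
Local Open Scope ring_scope.

Local Notation R := Rdefinitions.R.

Section Dynamics.
Context {T : topologicalType} {I : Type}.
Implicit Types (A : set T) (F : I -> T -> T).

Definition orbit_closure F (x : T) : set T := closure (range (F ^~ x)).

Definition restriction A (f : T -> T) (fA : set_fun A A f) : {ptws A -> A} :=
  fun z => exist _ (f (val z)) (mem_set (fA _ (set_mem (valP z)))).

Definition enveloping A F (FA : forall i, set_fun A A (F i)) :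
    set {ptws A -> A} :=
  closure (range (fun i => restriction (FA i))).

Lemma orbit_closure_stable F (x : T) :
  (forall i, continuous (F i)) ->
  (forall i j, exists l, F i \o F j = F l) ->
  forall i, set_fun (orbit_closure F x) (orbit_closure F x) (F i).
Proof.
move=> cF compF i y yO V /cF /yO [z [[j _ <-] Vz]].
have [l Fl] := compF i j.
by exists (F l x); split; [exists l | rewrite -Fl].
Qed.

End Dynamics.

(* Vectors indexed by {1, 2, 3, ...} are re-indexed by [nat]: the coordinate
   [l : nat] stands for the coordinate l + 1. *)
Definition Nvec := {fsfun nat -> nat with 0%N}.
HB.instance Definition _ := Choice.copy Nvec {fsfun nat -> nat with 0%N}.

Section NvecMonoid.
Implicit Types m n p : Nvec.

Definition vzero : Nvec := [fsfun for fun _ : nat => 0%N].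

Definition vadd m n : Nvec :=
  [fsfun l in (finsupp m `|` finsupp n)%fset => (m l + n l)%N | 0%N].

Lemma NvecP m n : (forall l, m l = n l) -> m = n.
Proof. by move=> mn; apply/fsfunP. Qed.

Lemma vzeroE l : vzero l = 0%N.
Proof. by rewrite /vzero fsfunE. Qed.

Lemma vaddE m n l : vadd m n l = (m l + n l)%N.
Proof.
rewrite /vadd fsfunE; case: ifPn => // /[!inE] /norP[ml nl].
by rewrite !fsfun_dflt.
Qed.

Lemma vaddA : associative vadd.
Proof. by move=> m n p; apply: NvecP => l; rewrite !vaddE addnA. Qed.

Lemma vaddC : commutative vadd.
Proof. by move=> m n; apply: NvecP => l; rewrite !vaddE addnC. Qed.

Lemma vadd0 : left_id vzero vadd.
Proof. by move=> m; apply: NvecP => l; rewrite vaddE vzeroE. Qed.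

End NvecMonoid.

HB.instance Definition _ := GRing.isNmodule.Build Nvec vaddA vaddC vadd0.

HB.instance Definition _ := hasNbhs.Build Nvec principal_filter.
HB.instance Definition _ := Discrete_ofNbhs.Build Nvec erefl.

Lemma NvecD (m n : Nvec) l : (m + n) l = (m l + n l)%N.
Proof. exact: vaddE. Qed.

Lemma Nvec0 l : (0 : Nvec) l = 0%N.
Proof. exact: vzeroE. Qed.

Definition vle (m n : Nvec) : Prop := forall l, (m l <= n l)%N.
Definition vlt (m n : Nvec) : Prop := vle m n /\ m <> n.


(* In 1-based indexing the last condition says that supp m lies in [1, N]. *)
Definition calB (N : nat) : set Nvec :=
  [set m | (forall l, (m l < N)%N) /\ (forall l, m l <> 0%N -> (l < N)%N)].

Record label := Label {
  lab : set Nvec;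
  lab_down : forall m m1, vle m1 m -> lab m -> lab m1 }.

Lemma labelP (M1 M2 : label) : lab M1 = lab M2 -> M1 = M2.
Proof.
case: M1 M2 => [A dA] [B dB] /= AB; rewrite -{}AB in dB *.
by rewrite (Prop_irrelevance dA dB).
Qed.

HB.instance Definition _ := gen_eqMixin label.
HB.instance Definition _ := gen_choiceMixin label.

Definition label0 : label := @Label set0 (fun _ _ _ => id).

Definition finite_type (M : label) : Prop :=
  ~ exists m : nat -> Nvec, forall i, lab M (m i) /\ vlt (m i) (m i.+1).

Definition agree (N : nat) (M1 M2 : label) : Prop :=
  lab M1 `&` calB N = lab M2 `&` calB N.

Definition label_dist (M1 M2 : label) : R :=
  inf [set x | exists2 N : nat, agree N M1 M2 & x = 2 ^- N].

Section LabelMetric.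
Implicit Types M : label.

Lemma calB_le N K : (N <= K)%N -> calB N `<=` calB K.
Proof.
move=> NK m [m1 m2]; split=> l; first exact: leq_trans (m1 l) NK.
by move=> /m2 lN; exact: leq_trans lN NK.
Qed.

Lemma calB_ex (m : Nvec) : exists N, calB N m.
Proof.
exists (\max_(l <- finsupp m) (maxn (m l) l)).+1; split=> l.
  rewrite ltnS; have [/eqP->//|ml] := boolP (m l == 0%N).
  apply: leq_trans (leq_maxl (m l) l) _.
  by apply: (leq_bigmax_seq (F := fun i => maxn (m i) i)); rewrite ?mem_finsupp.
move=> /eqP ml; rewrite ltnS; apply: leq_trans (leq_maxr (m l) l) _.
by apply: (leq_bigmax_seq (F := fun i => maxn (m i) i)); rewrite ?mem_finsupp.
Qed.

Lemma agreeP N M1 M2 :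
  agree N M1 M2 <-> forall m, calB N m -> lab M1 m <-> lab M2 m.
Proof.
split=> [M12 m Nm|M12]; last first.
  by apply/seteqP; split=> m [/M12 Mm Nm]; split=> //; exact: Mm.
have : (lab M1 `&` calB N) m = (lab M2 `&` calB N) m by rewrite M12.
by rewrite /setI /mkset propeqE; tauto.
Qed.

Lemma agree_le N K M1 M2 : (N <= K)%N -> agree K M1 M2 -> agree N M1 M2.
Proof.
by move=> NK /agreeP M12; apply/agreeP => m Nm; apply: M12; exact: calB_le Nm.
Qed.

Lemma agree0 M1 M2 : agree 0 M1 M2.
Proof. by apply/agreeP => m [/(_ 0%N)]. Qed.

Lemma agree_sym N M1 M2 : agree N M1 M2 -> agree N M2 M1.
Proof. by rewrite /agree => ->. Qed.

Lemma agree_trans N M2 M1 M3 : agree N M1 M2 -> agree N M2 M3 -> agree N M1 M3.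
Proof. by rewrite /agree => ->. Qed.

Let lower M1 M2 :
  lbound [set x : R | exists2 N : nat, agree N M1 M2 & x = 2 ^- N] 0.
Proof. by move=> _ [N _ ->]; rewrite invr_ge0 exprn_ge0. Qed.

Let hasinf M1 M2 :
  has_inf [set x : R | exists2 N : nat, agree N M1 M2 & x = 2 ^- N].
Proof.
by split; [exists (2 ^- 0), 0%N => //; exact: agree0|exists 0; exact: lower].
Qed.

Lemma label_dist_le N M1 M2 : agree N M1 M2 -> label_dist M1 M2 <= 2 ^- N.
Proof. by move=> M12; apply: ge_inf; [exists 0; exact: lower|exists N]. Qed.

Lemma label_dist_ge0 M1 M2 : 0 <= label_dist M1 M2.
Proof. by apply: lb_le_inf; [case: (hasinf M1 M2)|exact: lower]. Qed.

Lemma label_dist_lt (e : R) M1 M2 : label_dist M1 M2 < e ->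
  exists2 N : nat, agree N M1 M2 & 2 ^- N < e.
Proof.
move=> /inf_lt[//|_ [N M12 ->] Ne]; by [exact: (hasinf M1 M2).1|exists N].
Qed.

Lemma label_dist_agree N M1 M2 : label_dist M1 M2 < 2 ^- N -> agree N M1 M2.
Proof.
move=> /label_dist_lt[K M12 KN]; apply: agree_le M12; apply: ltnW.
by move: KN; rewrite ltf_pV2 ?posrE ?exprn_gt0// ltr_eXn2l// ltr1n.
Qed.

Lemma pow2_small (e : R) : 0 < e -> exists N : nat, 2 ^- N < e.
Proof.
move=> e0; have [N Ne] := ltr_add_invr e0.
exists N.+1; apply: le_lt_trans Ne; rewrite add0r lef_pV2 ?posrE ?exprn_gt0//.
by rewrite -natrX ler_nat ltnW// ltn_expl.
Qed.

Lemma label_distxx M : label_dist M M = 0.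
Proof.
apply/eqP; rewrite eq_le label_dist_ge0 andbT leNgt; apply/negP => d0.
have [N Nd] := pow2_small d0.
by have := lt_le_trans Nd (label_dist_le (erefl : agree N M M)); rewrite ltxx.
Qed.

Lemma label_dist_eq0 M1 M2 : label_dist M1 M2 = 0 -> M1 = M2.
Proof.
move=> d0; apply: labelP; apply/funext => m; apply/propext.
have [N Nm] := calB_ex m; suff /agreeP : agree N M1 M2 by apply.
by apply: label_dist_agree; rewrite d0 invr_gt0 exprn_gt0.
Qed.

Lemma label_dist_sym M1 M2 : label_dist M1 M2 = label_dist M2 M1.
Proof.
congr inf; apply/seteqP.
by split=> _ [N /agree_sym M12 ->]; exists N.
Qed.

Lemma label_dist_triangle M2 M1 M3 :
  label_dist M1 M3 <= label_dist M1 M2 + label_dist M2 M3.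
Proof.
rewrite leNgt; apply/negP => d13.
pose e := (label_dist M1 M3 - (label_dist M1 M2 + label_dist M2 M3)) / 2.
have e0 : 0 < e by rewrite divr_gt0// subr_gt0.
have [N N12 Ne] : exists2 N, agree N M1 M2 & 2 ^- N < label_dist M1 M2 + e.
  by apply: label_dist_lt; rewrite ltrDl.
have [K K23 Ke] : exists2 K, agree K M2 M3 & 2 ^- K < label_dist M2 M3 + e.
  by apply: label_dist_lt; rewrite ltrDl.
have : label_dist M1 M3 <= 2 ^- N + 2 ^- K.
  have p0 n : 0 <= 2 ^- n :> R by rewrite invr_ge0 exprn_ge0.
  have [NK|/ltnW KN] := leqP N K.
    rewrite (le_trans (label_dist_le (agree_trans N12 (agree_le NK K23))))//.
    by rewrite lerDl.
  rewrite (le_trans (label_dist_le (agree_trans (agree_le KN N12) K23)))//.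
  by rewrite lerDr.
have e2 : e + e = label_dist M1 M3 - (label_dist M1 M2 + label_dist M2 M3).
  by rewrite /e -splitr.
move=> h; have := le_lt_trans h (ltrD Ne Ke).
by rewrite addrACA e2 addrC subrK ltxx.
Qed.

End LabelMetric.

HB.instance Definition _ := isMetric.Build R label
  label_distxx label_dist_eq0 label_dist_sym label_dist_triangle.

Lemma P_down (r : Nvec) (M : label) (m m1 : Nvec) :
  vle m1 m -> lab M (m + r) -> lab M (m1 + r).
Proof.
by move=> mm; apply: (@lab_down M (m + r)) => l; rewrite !NvecD leq_add2r.
Qed.

Definition P (r : Nvec) (M : label) : label :=
  @Label [set w | lab M (w + r)] (@P_down r M).

Lemma P0 M : P 0 M = M.
Proof. by apply: labelP; apply/funext => w; rewrite /= addr0. Qed.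

Lemma PD r s M : P (r + s) M = P r (P s M).
Proof. by apply: labelP; apply/funext => w; rewrite /= addrA. Qed.

Lemma P_continuous r : continuous (P r).
Proof.
move=> M V /nbhs_ballP[e /= e0 eV]; have [N Ne] := pow2_small e0.
have [K Kr] := calB_ex r; apply/nbhs_ballP.
exists (2 ^- (N + K)) => /=; first by rewrite invr_gt0 exprn_gt0.
move=> M'; rewrite ballEmdist => /label_dist_agree /agreeP MM'.
apply: eV; rewrite ballEmdist /=.
apply: le_lt_trans Ne; apply: label_dist_le; apply/agreeP => m [m1 m2].
apply: MM'; split=> l; rewrite NvecD.
  by case: Kr => r1 _; rewrite -addSn leq_add// ltnW.
case: (eqVneq (m l) 0%N) => [->|/eqP /m2 lN _]; last exact: ltn_addr.
by rewrite add0n => /Kr.2 lK; exact: ltn_addl.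
Qed.

Definition Theta (M : label) : set label := orbit_closure P M.

Lemma P_Theta M r : set_fun (Theta M) (Theta M) (P r).
Proof.
apply: orbit_closure_stable; first exact: P_continuous.
by move=> i j; exists (i + j); apply/funext => N /=; rewrite PD.
Qed.

Definition P_on (M : label) (r : Nvec) : {ptws Theta M -> Theta M} :=
  restriction (@P_Theta M r).
Arguments P_on : clear implicits.

Definition ETheta (M : label) : set {ptws Theta M -> Theta M} :=
  enveloping (@P_Theta M).
Arguments ETheta : clear implicits.

Definition config := {ptws int -> bool}.

Definition shift (x : config) : config := fun t => x (t + 1).

(* The n-th power S^n of the shift; see [shiftz1] and [shiftzD]. *)
Definition shiftz (n : int) (x : config) : config := fun t => x (t + n).

Lemma shiftz1 : shiftz 1 = shift. Proof. by []. Qed.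

Lemma shiftzD m n x : shiftz (m + n) x = shiftz m (shiftz n x).
Proof. by apply/funext => t; rewrite /shiftz addrA. Qed.

Lemma shiftz0 x : shiftz 0 x = x.
Proof. by apply/funext => t; rewrite /shiftz addr0. Qed.

Lemma shiftz_continuous n : continuous (shiftz n).
Proof.
move=> x; apply/cvg_sup => t; apply: continuous_comp_initial x.
exact: (@proj_continuous int (fun=> bool) (t + n)).
Qed.

Definition X (x : config) : set config := orbit_closure shiftz x.

Lemma shiftz_X x n : set_fun (X x) (X x) (shiftz n).
Proof.
apply: orbit_closure_stable; first exact: shiftz_continuous.
by move=> i j; exists (i + j); apply/funext => z /=; rewrite shiftzD.
Qed.

Definition S_on (x : config) (n : int) : {ptws X x -> X x} :=
  restriction (@shiftz_X x n).
Arguments S_on : clear implicits.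

Definition ES (x : config) : set {ptws X x -> X x} :=
  enveloping (@shiftz_X x).
Arguments ES : clear implicits.

Definition is_min (A : set nat) (m : nat) : Prop := A m /\ lbound A m.

(* [D l] is D_{l+1} in 1-based indexing; its elements are positive. *)
Record partition_of_N (D : nat -> set nat) : Prop := {
  partition_cover : \bigcup_l D l = [set n | (0 < n)%N];
  partition_disjoint : trivIset setT D;
  partition_infinite : forall l, infinite_set (D l);
  partition_min : forall l m n,
    is_min (D l) m -> is_min (D l.+1) n -> (m < n)%N }.

Section LabelSubshifts.
Context (b : nat) (D : nat -> set nat).

Definition k (n : int) : int :=
  match n with
  | Posz 0 => 0
  | Posz n'.+1 => (b ^ n')%:Z
  | Negz n' => - (b ^ n')%:Z
  end.

Lemma kN n : k (- n) = - k n.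
Proof. by case: n => [[|n]|n] //=; rewrite ?oppr0 ?opprK. Qed.

Definition finite_sums (B : set int) : set int :=
  [set t | exists2 F : {fset int}, [set` F] `<=` B & t = \sum_(a <- F) a].

Definition IP : set int := finite_sums (range k).
Definition IPplus : set int := finite_sums (k @` [set n | 0 <= n]).

Definition expansion (t : int) (s : seq int) : Prop :=
  [/\ sorted (fun i j => `|j| < `|i|)%N s, all (fun j => 0 < `|j|)%N s
    & t = \sum_(j <- s) k j].

(* On IP(k) the expansion exists and is unique, so the default value 0 only
   occurs outside of IP(k). *)
Definition length_vector (t : int) : Nvec :=
  xget 0 [set r : Nvec | exists2 s, expansion t s &
    forall l, r l = count (fun j => `|j|%N \in D l) s].

Definition A_ (M : label) : set int :=
  [set t | IP t /\ lab M (length_vector t)].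
Definition Aplus (M : label) : set int := A_ M `&` IPplus.

Definition xlab (M : label) : config := fun t => t \in A_ M.
Definition xplus (M : label) : config := fun t => t \in Aplus M.

End LabelSubshifts.

Definition e_fix : config := fun=> false.

Lemma xlab0 b D : xlab b D label0 = e_fix.
Proof. by apply/funext => t; apply/negbTE/negP => /set_mem[]. Qed.

Lemma xplus0 b D : xplus b D label0 = e_fix.
Proof. by apply/funext => t; apply/negbTE/negP => /set_mem[[]]. Qed.

Lemma shift_e_fix : shift e_fix = e_fix. Proof. by []. Qed.

(* q(x[N]) = x[Q(N)] for all N in Theta(M); this includes x[N] \in X(M). *)
Definition intertwines (x : label -> config) (M : label)
    (Q : {ptws Theta M -> Theta M}) (q : {ptws X (x M) -> X (x M)}) : Prop :=
  forall N : Theta M, exists2 z : X (x M),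
    val z = x (val N) & val (q z) = x (val (Q N)).
Arguments intertwines : clear implicits.

Definition continuous_action (Z : topologicalType) (p : Nvec -> Z -> Z) :
    Prop :=
  [/\ p 0 = id, forall r s, p (r + s) = p r \o p s
    & continuous (fun rz : Nvec * Z => p rz.1 rz.2)].

(* Main.v *)
Require Import Defs.
From mathcomp Require Import all_boot all_order all_algebra.
From mathcomp Require Import finmap.
From mathcomp Require Import all_classical all_reals all_analysis.
From mathcomp Require Import Rstruct.
From mathcomp Require Import zify ring.
Set Implicit Arguments.
Unset Strict Implicit.
Unset Printing Implicit Defensive.
Import Order.TTheory GRing.Theory Num.Theory.
Local Open Scope classical_set_scope.
Local Open Scope ring_scope.

(** The elements of IP(k) are handled through their digits -1, 0 and 1 in base
    [b]. A sum of powers of [b] with coefficients of absolute value less than 5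
    vanishes only if all the coefficients do, so these digits are unique, and
    sums and differences of few elements can be compared digit by digit.

    Call a time [t] deep if it is in IP(k) and has no digits in the first [n]
    positions, for a large [n]. Adding [t] to a number [s] that is small
    compared with [b ^ n] just puts the digits side by side, so [s + t] is in
    A[N] exactly when [s] is in A[N - r(t)] (lemma [x_deep]). Seen from a deep
    time, x[N] looks like x[N - r(t)]. Deep times have arbitrary length vectors,
    because each block of the partition is infinite. Hence if translations of
    labels converge to [Q], shifts along deep times with the same vectors
    converge to a map that sends x[N] to x[Q(N)].

    The converse rests on the finite type of [M]. Suppose that times [a] vary
    along an ultrafilter and stay in sets A[N] with [N] in Theta(M). The digit
    of [a] at each position is eventually constant, and infinitely many nonzero
    limiting digits would give an infinite strictly increasing sequence in [M].
    So [a] is eventually a constant plus a deep time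
    ([digit_sums_constant_part]). This describes the limits of shifts of x[N]
    that have a value 1 at some place, and there are three consequences. Each
    point of X(M) is a shift of some x[N] with [N] in Theta(M)
    ([X_shift_form]), so that an element of the enveloping semigroup, commuting
    with the shift, is determined by its values on the x[N]. Each element other
    than the constant one is a power of the shift followed by the map induced by
    some [Q] ([shifted_config_map_exists]). And the maps induced by the
    translations are continuous, since both a point and its image are described
    by the same deep times ([config_map_P_continuous]).

    In the decomposition the power of the shift is unique because a shift by
    [d <> 0] never maps x[N] with [N] nonempty to some x[N']: it would make [d],
    [- d] and [2 d] elements of IP(k) ([x_shift_inj]).

    The one-sided sets A_+[N] only differ by the set of admissible digits, which
    is a parameter in what follows. *)

(** * Convergence and ultrafilters *)

Section Convergence.
Context {I : Type} (F : set_system I) {FF : Filter F}.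

Lemma cvg_initial (S : choiceType) (T : topologicalType) (f : S -> T)
    (y : I -> S) (s : S) :
  y @ F --> (s : initial_topology f) <-> (f \o y) @ F --> f s.
Proof.
split=> [ys|fys A /= [_ [[B oB <-] Bs BA]]].
  exact: (cvg_comp y f ys (@initial_continuous S T f s)).
have : nbhs (f s) B by apply: open_nbhs_nbhs.
move=> /fys; rewrite !nbhs_simpl => FB; change (F (y @^-1` A)).
by apply: (@filterS _ F _ _ _ _ FB) => i; exact: BA.
Qed.

Lemma cvg_set_type (T : topologicalType) (A : set T) (y : I -> A) (z : A) :
  y @ F --> z <-> (fun i => val (y i)) @ F --> val z.
Proof. exact: (@cvg_initial (set_type A) T set_val y z). Qed.

Lemma cvg_ptws (U : Type) (V : topologicalType) (y : I -> {ptws U -> V})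
    (q : {ptws U -> V}) :
  y @ F --> q <-> forall z, (fun i => y i z) @ F --> q z.
Proof.
rewrite cvg_sup; split=> yq z; first by have /cvg_initial := yq z.
exact/cvg_initial/yq.
Qed.

Lemma cvg_config (y : I -> config) (x : config) :
  y @ F --> x <-> forall s, \forall i \near F, y i s = x s.
Proof.
rewrite cvg_ptws; split=> yx s.
  exact: (yx s [set x s] (discrete_set1 _)).
move=> B /= Bx; apply: filterS (yx s) => i yis; change (B (y i s)); rewrite yis.
exact: nbhs_singleton.
Qed.

(** Only finitely many vectors lie in each [calB K], so convergence of labels
    is convergence of the membership of each vector. *)
Lemma cvg_label (y : I -> label) (N : label) :
  y @ F --> N <-> forall m, \forall i \near F, lab (y i) m <-> lab N m.
Proof.
split=> [yN m|yN A /nbhs_ballP[e /= e0 eA]].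
  have [K Km] := calB_ex m.
  have : nbhs N (ball N (2 ^- K : Rdefinitions.R)).
    by apply: nbhsx_ballx; rewrite invr_gt0 exprn_gt0.
  move=> /yN FB; apply: (@filterS _ F _ _ _ _ FB) => i /=; rewrite ballEmdist.
  by move=> /label_dist_agree/agreeP/(_ m Km); tauto.
have [K Ke] := pow2_small e0.
suff : \forall i \near F, agree K N (y i).
  apply: (@filterS _ F) => i /label_dist_le Ni; apply: eA.
  rewrite ballEmdist /=.
  exact: le_lt_trans Ni Ke.
(* [calB K] is finite: its vectors are determined by a function on ['I_K]. *)
have : \forall i \near F, forall f : {ffun 'I_K -> 'I_K}, forall m, calB K m ->
    (forall l : 'I_K, m l = f l) -> (lab (y i) m <-> lab N m).
  apply: filter_forall => f.
  have [[m [Km mf]]|nof] := pselect (exists m, calB K m /\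
      forall l : 'I_K, m l = f l); last first.
    by apply: nearW => i m Km mf; case: nof; exists m.
  apply: filterS (yN m) => i yi m' Km' m'f; suff -> : m' = m by [].
  apply: NvecP => l; have [lK|Kl] := ltnP l K.
    by rewrite (m'f (Ordinal lK)) (mf (Ordinal lK)).
  have out p : calB K p -> p l = 0%N.
    by case=> _ p2; apply: contrapT => /p2; rewrite ltnNge Kl.
  by rewrite !out.
apply: filterS => i yi; apply/agreeP => m Km.
suff mf : forall l : 'I_K, m l = [ffun l : 'I_K => Ordinal (Km.1 l)] l.
  by have := yi _ m Km mf; tauto.
by move=> l; rewrite ffunE.
Qed.

End Convergence.

(** An ultrafilter on the index set plays the role of a convergent subnet: it
    describes a point of the closure and at the same time decides every property
    of the index, which replaces all compactness arguments below. *)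
Lemma closure_rangeP (T : topologicalType) (I : Type) (f : I -> T) (q : T) :
  closure (range f) q <-> exists2 F, UltraFilter F & f @ F --> q.
Proof.
split=> [qf|[F FU fq] A /fq FA]; last first.
  have [i Ai] := @filter_ex _ F _ _ FA.
  by exists (f i); split => //; exists i.
pose G := filter_from (nbhs q) (fun A => f @^-1` A).
have GP : ProperFilter G.
  apply: filter_from_proper; last first.
    by move=> A /qf[_ [[i _ <-] Ai]]; exists i.
  apply: filter_from_filter; first by exists setT; exact: filterT.
  by move=> A B qA qB; exists (A `&` B) => //; exact: filterI.
have [F [FU GF]] := ultraFilterLemma GP.
by exists F => // A qA; apply: GF; exists A.
Qed.

Lemma closure_range_proper (T : topologicalType) (I : Type) (f : I -> T) (q : T)
    (F : set_system I) : ProperFilter F -> f @ F --> q -> closure (range f) q.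
Proof.
move=> FP fq A /fq FA; have [i Ai] := @filter_ex _ F _ _ FA.
by exists (f i); split=> //; exists i.
Qed.

(** If the preimage of a neighbourhood of [f z] failed to be a neighbourhood of
    [z], an ultrafilter converging to [z] would contain its complement. *)
Lemma continuous_ultra (S T : topologicalType) (f : S -> T) (z : S) :
  (forall F : set_system S, UltraFilter F -> F --> z -> f @ F --> f z) ->
  {for z, continuous f}.
Proof.
move=> fF A /= Afz; apply: contrapT => nA.
have WP : ProperFilter (within (~` (f @^-1` A)) (nbhs z)).
  apply: Build_ProperFilter_ex => B zB; apply: contrapT => B0; apply: nA.
  change (nbhs z (f @^-1` A)).
  apply: (@filterS _ (nbhs z) _ _ _ _ zB) => y By; apply: contrapT => Afy.
  by apply: B0; exists y; exact: By.
have [F [FU WF]] := ultraFilterLemma WP.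
have Fz : F --> z by move=> B zB; apply: WF; exact: filterS zB.
have FA : F (f @^-1` A) by exact: fF.
have FnA : F (~` (f @^-1` A)) by apply: WF; exact: withinT.
by have [y []] := filter_ex (filterI FA FnA).
Qed.

Lemma ultra_near_iff (I : Type) (F : set_system I) (B : set I) :
  UltraFilter F -> \forall i \near F, B i <-> F B.
Proof.
move=> FU; have [FB|FnB] := in_ultra_setVsetC B FU.
  by apply: filterS (FB) => i Bi; split.
apply: filterS (FnB) => i nBi; split=> // FB.
by have [j []] := filter_ex (filterI FB FnB).
Qed.

(** * Expansions with small digits *)

Lemma posz_exp (b n : nat) : (b ^ n)%:Z = b%:Z ^+ n.
Proof. by rewrite -[b%:Z]natz -natrX natz. Qed.

Section Digits.
Context (b : nat) (b_ge5 : (5 <= b)%N).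

Local Notation "p .[b]" := (horner p b%:Z) (at level 2, format "p .[b]").

Let b_gt0 : (0 < b%:Z). Proof. by rewrite ltz_nat; exact: leq_trans b_ge5. Qed.

(** Reduction modulo [b] forces the constant coefficient to vanish, and dividing
    by [b] the others follow. The bound leaves room for combinations of up to
    four expansions with digits in {-1, 0, 1}. *)
Lemma small_coef_eq0 (p : {poly int}) :
  (forall i, `|p`_i| < 5) -> p.[b] = 0 -> p = 0.
Proof.
elim/poly_ind: p => // p c IHp small; rewrite hornerMXaddC => pc0.
have c0 : c = 0.
  have := small 0%N; rewrite coefD coefMX coefC /= add0r => c5.
  have /dvdzP[w cw] : (b%:Z %| c)%Z.
    apply/dvdzP; exists (- p.[b]); apply/eqP.
    by rewrite mulNr -addr_eq0 addrC pc0.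
  move: c5; rewrite cw normrM (ger0_norm (ltW b_gt0)).
  have [->|w0] := eqVneq w 0; first by rewrite mul0r.
  have w1 : 1 <= `|w| by rewrite -gtz0_ge1 normr_gt0.
  have b5 : 5 <= b%:Z by rewrite lez_nat.
  nia.
have p0 : p = 0.
  apply: IHp => [i|].
    by have := small i.+1; rewrite coefD coefMX coefC /= addr0.
  move/eqP: pc0; rewrite c0 addr0 mulf_eq0 (gt_eqF b_gt0) orbF => /eqP.
  by [].
by rewrite p0 c0 mul0r addr0.
Qed.

Definition unit_digits (p : {poly int}) := forall i, `|p`_i| <= 1.

Lemma unit_digits_inj p q :
  unit_digits p -> unit_digits q -> p.[b] = q.[b] -> p = q.
Proof.
move=> p1 q1 pq; apply/eqP; rewrite -subr_eq0; apply/eqP/small_coef_eq0.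
  move=> i; rewrite coefB; move: (p1 i) (q1 i).
  by move: (p`_i) (q`_i) => x y; lia.
by rewrite hornerD hornerN pq subrr.
Qed.

Lemma unit_digits_take n p : unit_digits p -> unit_digits (take_poly n p).
Proof. by move=> p1 i; rewrite coef_take_poly; case: ifP. Qed.

(** A sum of unit digits below position [n] is less than half of [b ^ n]: this
    is what lets it be read off from a residue modulo [b ^ n]. *)
Lemma take_horner_bound n p :
  unit_digits p -> 2 * `|(take_poly n p).[b]| < b%:Z ^+ n.
Proof.
move=> p1; rewrite (horner_coef_wide _ (size_take_poly n p)).
under eq_bigr => i _ do rewrite coef_take_poly ltn_ord.
elim: n => [|n IHn]; first by rewrite big_ord0.
rewrite big_ord_recr /= exprS.
set s := \sum_(i < n) _ in IHn *; have := p1 n.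
have bn : 0 < b%:Z ^+ n by rewrite exprn_gt0.
have b5 : 5 <= b%:Z by rewrite lez_nat.
have h : `|p`_n * b%:Z ^+ n| <= b%:Z ^+ n.
  by rewrite normrM (gtr0_norm bn) ler_piMl// ltW.
move: (ler_normD s (p`_n * b%:Z ^+ n)) h IHn bn.
move: (b%:Z ^+ n) (`|s|) (`|p`_n * _|) (`|s + _|) => B A C E; nia.
Qed.

(** The difference of [s] and of the low part of the expansion of [s + t] is a
    multiple of [b ^ n] of absolute value less than [b ^ n]. *)
Lemma low_part n (s t : int) g : unit_digits g -> s + t = g.[b] ->
  (b%:Z ^+ n %| t)%Z -> 2 * `|s| < b%:Z ^+ n -> s = (take_poly n g).[b].
Proof.
move=> g1 stg /dvdzP[w tw] sn; have gn := take_horner_bound n g1.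
move: stg; rewrite -{1}(poly_take_drop n g) hornerD hornerM hornerXn tw.
set v := (drop_poly n g).[b]; set u := (take_poly n g).[b] in gn *.
move=> e; have sue : s - u = (v - w) * b%:Z ^+ n.
  by rewrite -(addrK (w * b%:Z ^+ n) s) e; ring.
have [vw|vw] := eqVneq (v - w) 0.
  by apply/eqP; rewrite -subr_eq0 sue vw mul0r.
have bn : 0 < b%:Z ^+ n by rewrite exprn_gt0.
have vw1 : 1 <= `|v - w| by rewrite -gtz0_ge1 normr_gt0.
have : b%:Z ^+ n <= `|s - u|.
  by rewrite sue normrM (gtr0_norm bn) ler_peMl// ltW.
lia.
Qed.

End Digits.

(** * Vectors of block counts *)

Definition unit_vector (l : nat) : Nvec :=
  [fsfun i in [fset l]%fset => 1%N | 0%N].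

Lemma unit_vectorE l i : unit_vector l i = (i == l).
Proof. by rewrite fsfunE inE; case: eqP. Qed.

Lemma Nvec_sumE (J : Type) (s : seq J) (Q : pred J) (f : J -> Nvec) l :
  (\sum_(j <- s | Q j) f j) l = (\sum_(j <- s | Q j) f j l)%N.
Proof.
apply: (big_morph (fun v : Nvec => v l)) => [u v|]; first exact: NvecD.
exact: Nvec0.
Qed.

(** Vectors are built up from 0 by adding one unit vector at a time. *)
Lemma Nvec_ind (Pr : Nvec -> Prop) :
  Pr 0 -> (forall r l, Pr r -> Pr (r + unit_vector l)) -> forall r, Pr r.
Proof.
move=> Pr0 PrD r.
have -> : r = \sum_(l <- finsupp r) unit_vector l *+ r l.
  have mulnE v n i : ((v : Nvec) *+ n) i = (v i * n)%N.
    by elim: n => [|n IHn]; rewrite ?Nvec0 ?muln0// mulrSr NvecD IHn mulnSr.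
  apply: NvecP => i; rewrite Nvec_sumE.
  under eq_bigr => l _ do rewrite mulnE unit_vectorE.
  have [ir|ir] := boolP (i \in finsupp r).
    rewrite (big_fsetD1 i)//= eqxx mul1n big1_fset ?addn0// => l.
    by rewrite !inE => /andP[li _] _; rewrite eq_sym (negbTE li).
  rewrite fsfun_dflt// big1_fset// => l lr _; case: eqP => // il.
  by rewrite il lr in ir.
elim: (X in \sum_(_ <- X) _) => [|l s IHs]; first by rewrite big_nil.
rewrite big_cons addrC; elim: (r l) => [|n IHn]; first by rewrite addr0.
by rewrite mulrSr addrA; exact: PrD.
Qed.

Lemma finite_type_proper (M : label) : finite_type M -> exists r, ~ lab M r.
Proof.
move=> Mfin; apply: contrapT => full; apply: Mfin.
exists (fun n => unit_vector 0 *+ n) => n; split.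
  by apply: contrapT => nM; apply: full; exists (unit_vector 0 *+ n).
rewrite mulrSr; split=> [l|]; first by rewrite NvecD leq_addr.
move/(congr1 (fun v : Nvec => v 0%N)); rewrite NvecD unit_vectorE eqxx.
by move/eqP; rewrite -[X in X == _]addn0 eqn_add2l.
Qed.

Lemma vle_addr (u v : Nvec) : vle u (u + v).
Proof. by move=> l; rewrite NvecD leq_addr. Qed.

Section Expansion.
Context (b : nat) (b_ge5 : (5 <= b)%N).
Context (D : nat -> set nat) (D_part : partition_of_N D).
Local Notation "p .[b]" := (horner p b%:Z) (at level 2, format "p .[b]").

(** The index of the block of the partition that contains the position [i + 1],
    the one of the digit at [b ^ i]. *)
Definition block (i : nat) : nat := xget 0%N [set l | D l i.+1].

Lemma blockP i : D (block i) i.+1.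
Proof.
have [l _ li] : (\bigcup_l D l) i.+1 by rewrite (partition_cover D_part).
exact: (@xgetI _ 0%N [set l | D l i.+1] l).
Qed.

Lemma blockE l i : (l == block i) = (i.+1 \in D l).
Proof.
apply/eqP/idP => [->|/set_mem li]; first exact/mem_set/blockP.
apply: (partition_disjoint D_part) => //.
by exists i.+1; split => //; exact: blockP.
Qed.

Lemma block_unbounded l n : exists2 i, (n <= i)%N & block i = l.
Proof.
apply: contrapT => no; apply: (@partition_infinite _ D_part l).
apply: (@sub_finite_set _ _ `I_n.+1); last exact: finite_II.
move=> i li /=; rewrite ltnNge; apply/negP => ni; apply: no.
case: i li ni => [//|i] li ni; exists i => //.
by apply/esym/eqP; rewrite blockE; exact/mem_set.
Qed.

Definition support_vector (p : {poly int}) : Nvec :=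
  \sum_(i < size p | p`_i != 0) unit_vector (block i).

Lemma support_vectorE n (p : {poly int}) : (size p <= n)%N ->
  support_vector p = \sum_(i < n | p`_i != 0) unit_vector (block i).
Proof.
move=> pn; rewrite /support_vector.
rewrite (big_ord_widen_cond n (fun i => p`_i != 0)
  (fun i => unit_vector (block i)))//.
apply: eq_bigl => i; case: eqVneq => //= pi.
by rewrite ltnNge; apply/negP => /(nth_default 0) e; rewrite e eqxx in pi.
Qed.

Lemma support_vectorD (p q : {poly int}) : (forall i, p`_i = 0 \/ q`_i = 0) ->
  support_vector (p + q) = support_vector p + support_vector q.
Proof.
move=> pq; pose n := maxn (size p) (size q).
have [pn qn] : (size p <= n)%N /\ (size q <= n)%N.
  by rewrite leq_maxl leq_maxr.
rewrite (support_vectorE pn) (support_vectorE qn).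
rewrite (@support_vectorE n) ?(leq_trans (size_polyD p q))//.
rewrite big_mkcond [in RHS]big_mkcond [X in _ = _ + X]big_mkcond -big_split.
apply: eq_bigr => i _ /=; rewrite coefD.
have [->|->] := pq i; first by rewrite (add0r q`_i) eqxx (add0r (_ : Nvec)).
by rewrite (addr0 p`_i) eqxx (addr0 (_ : Nvec)).
Qed.

Lemma support_vectorN p : support_vector (- p) = support_vector p.
Proof.
rewrite /support_vector size_polyN; apply: eq_bigl => i.
by rewrite coefN oppr_eq0.
Qed.

Lemma support_vectorXn c i : c != 0 ->
  support_vector (c *: 'X^i) = unit_vector (block i).
Proof.
move=> c0; rewrite (@support_vectorE i.+1); last first.
  by rewrite (leq_trans (size_scale_leq _ _))// size_polyXn.
rewrite (bigD1 ord_max)/= ?coefZ ?coefXn ?eqxx ?mulr1//.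
rewrite big1 ?addr0// => j /andP[]; rewrite coefZ coefXn => cj ji.
by move: cj; rewrite -val_eqE /= in ji; rewrite (negbTE ji) mulr0 eqxx.
Qed.

Lemma support_vector_take n p :
  support_vector (take_poly n.+1 p) = support_vector (take_poly n p) +
    (if p`_n == 0 then 0 else unit_vector (block n)).
Proof.
have -> : take_poly n.+1 p = take_poly n p + p`_n *: 'X^n.
  apply/polyP => i; rewrite coefD coefZ coefXn !coef_take_poly ltnS leq_eqVlt.
  case: (eqVneq i n) => [->|] /=; first by rewrite ltnn mulr1 add0r.
  by rewrite mulr0 addr0.
rewrite support_vectorD; last first.
  move=> i; rewrite coefZ coefXn coef_take_poly.
  case: (eqVneq i n) => [->|]; first by rewrite ltnn; left.
  by rewrite mulr0; right.
have [->|p0] := eqVneq p`_n 0; last by rewrite support_vectorXn.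
by rewrite scale0r /support_vector size_poly0 big_ord0.
Qed.

(** The length vector read off from a polynomial of digits; the expansion by
    decreasing indices behind [length_vector] is compared with it later. *)
Definition rvec (t : int) : Nvec :=
  support_vector (xget 0 [set p | unit_digits p /\ t = p.[b]]).

Lemma rvecE p : unit_digits p -> rvec p.[b] = support_vector p.
Proof.
move=> p1; congr support_vector; apply: xget_unique => //.
by move=> q [q1] /(unit_digits_inj b_ge5 p1 q1).
Qed.

End Expansion.

(** * Sums of digits and their arithmetic *)

Section DigitSets.
Context (b : nat) (b_ge5 : (5 <= b)%N).
Context (D : nat -> set nat) (D_part : partition_of_N D).
Context (dig : pred int) (dig0 : dig 0) (dig1 : dig 1)
  (dig_unit : forall c, dig c -> `|c| <= 1).
Local Notation "p .[b]" := (horner p b%:Z) (at level 2, format "p .[b]").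
Local Notation rv := (rvec b D).

(** Leaving the set of digits open treats IP(k), with digits -1, 0 and 1, and
    IP_+(k), with digits 0 and 1, at the same time. *)
Definition digit_sums : set int :=
  [set t | exists2 p : {poly int}, (forall i, dig p`_i) & t = p.[b]].

Lemma dig_digits (p : {poly int}) : (forall i, dig p`_i) -> unit_digits p.
Proof. by move=> dp i; exact: dig_unit. Qed.

Lemma dig_take n (p : {poly int}) :
  (forall i, dig p`_i) -> forall i, dig (take_poly n p)`_i.
Proof. by move=> dp i; rewrite coef_take_poly; case: ifP. Qed.

Lemma digit_sums0 : digit_sums 0.
Proof. by exists 0; [move=> i; rewrite coef0|rewrite horner0]. Qed.

Lemma rvec0 : rv 0 = 0.
Proof.
rewrite -(horner0 b%:Z) (rvecE b_ge5) /support_vector ?size_poly0 ?big_ord0//.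
by move=> i; rewrite coef0.
Qed.

(** The part of the expansion below position [n] is a multiple of [b ^ n] and
    less than [b ^ n] in absolute value. *)
Lemma deep_take_eq0 n f : unit_digits f -> (b%:Z ^+ n %| f.[b])%Z ->
  take_poly n f = 0.
Proof.
move=> f1 fn; apply: (unit_digits_inj b_ge5).
- exact: unit_digits_take.
- by move=> i; rewrite coef0.
rewrite horner0; apply/esym; apply: (low_part b_ge5 f1 _ fn).
  by rewrite add0r.
by rewrite normr0 mulr0 exprn_gt0// ltz_nat (leq_trans _ b_ge5).
Qed.

(** A number that is small compared with [b ^ n] can only use positions below
    [n], and [t] only positions from [n] on, so that no digits interact. *)
Lemma digit_sums_deepD n s t :
  digit_sums t -> (b%:Z ^+ n %| t)%Z -> 2 * `|s| < b%:Z ^+ n ->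
  (digit_sums (s + t) <-> digit_sums s) /\
  (digit_sums s -> rv (s + t) = rv s + rv t).
Proof.
move=> [f df tf] tn sn; have f0 : take_poly n f = 0.
  by apply: deep_take_eq0; [exact: dig_digits|rewrite -tf].
have disj (h : {poly int}) i : (take_poly n h)`_i = 0 \/ f`_i = 0.
  have [ni|ni] := ltnP i n; last by left; rewrite coef_take_poly ltnNge ni.
  by right; move/polyP: f0 => /(_ i); rewrite coef_take_poly ni coef0.
suff sP : digit_sums s -> digit_sums (s + t) /\ rv (s + t) = rv s + rv t.
  split=> [|/sP[]//]; split=> [[g dg stg]|/sP[]//].
  exists (take_poly n g); first exact: dig_take.
  exact: (low_part b_ge5 (dig_digits dg) stg).
case=> h dh sh; have hE : take_poly n h = h.
  apply: (unit_digits_inj b_ge5); [|exact: dig_digits|].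
    exact/unit_digits_take/dig_digits.
  rewrite -sh; apply/esym.
  apply: (low_part (t := 0) b_ge5 (dig_digits dh) _ _ sn).
    by rewrite addr0.
  exact: dvdz0.
have dhf i : dig (h + f)`_i.
  have [|fi0] := disj h i; rewrite coefD; last by rewrite fi0 (addr0 h`_i).
  by rewrite hE => ->; rewrite (add0r f`_i).
have -> : s + t = (h + f).[b] by rewrite hornerD sh tf.
split; first by exists (h + f).
rewrite (rvecE b_ge5) ?sh ?tf ?(rvecE b_ge5); try exact: dig_digits.
by rewrite support_vectorD// -hE.
Qed.

(** Each block is infinite, so each unit of a vector can be realized by a digit
    1 at a position as far out as desired and not yet used. *)
Lemma digit_sums_deep_rvec r n :
  exists t, [/\ digit_sums t, (b%:Z ^+ n %| t)%Z & rv t = r].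
Proof.
elim/Nvec_ind: r n => [|r l IHr] n.
  by exists 0; split; [exact: digit_sums0|exact: dvdz0|exact: rvec0].
have [_ [[f df ->] fn <-]] := IHr n.
have [i ni <-] := block_unbounded D_part l (maxn n (size f)).
move: ni; rewrite geq_max => /andP[ni fi].
have disj j : f`_j = 0 \/ ('X^i : {poly int})`_j = 0.
  have [->|ij] := eqVneq j i; [by left; exact: nth_default|right].
  by rewrite coefXn (negbTE ij).
have dg j : dig (f + 'X^i)`_j.
  rewrite coefD; have [->|->] := disj j; last by rewrite addr0.
  by rewrite add0r coefXn; case: eqP.
exists (f + 'X^i).[b]; split; first by exists (f + 'X^i).
  rewrite hornerD hornerXn rpredD//=; apply/dvdzP.
  by exists (b%:Z ^+ (i - n)); rewrite -exprD subnK.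
rewrite !(rvecE b_ge5) ?support_vectorD//; try exact: dig_digits.
by congr (_ + _); rewrite -['X^i]scale1r support_vectorXn.
Qed.

(** Otherwise the digits of [- d - d] would be 2 or -2 somewhere. *)
Lemma digit_sumsN_eq0 d :
  digit_sums d -> digit_sums (- d) -> digit_sums (- d - d) -> d = 0.
Proof.
move=> [f df ->] _ [g dg fg].
have f1 := dig_digits df; have g1 := dig_digits dg.
suff -> : f = 0 by rewrite horner0.
have gf0 : g + f + f = 0.
  apply: (small_coef_eq0 b_ge5) => [i|]; last by rewrite !hornerD -fg; ring.
  rewrite !coefD; move: (f1 i) (g1 i).
  by move: (f`_i) (g`_i) => x y; clear; lia.
apply/polyP => i; move/polyP: gf0 => /(_ i); rewrite !coefD !coef0.
by move: (g1 i); move: (f`_i) (g`_i) => x y; clear; lia.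
Qed.

Lemma rvecN d : digit_sums d -> rv (- d) = rv d.
Proof.
move=> [f /dig_digits f1 ->]; rewrite -hornerN !(rvecE b_ge5)//.
  exact: support_vectorN.
by move=> i; rewrite coefN normrN.
Qed.

Section KeyLemma.
Context (M : label) (M_fin : finite_type M).
Context (I : Type) (F : set_system I) {FU : UltraFilter F} (a : I -> int).
Hypothesis aM : \forall i \near F, digit_sums (a i) /\ lab M (rv (a i)).

(** Seen through an ultrafilter, the digits of [a i] at each position are
    eventually constant. The vectors of the initial segments of the limiting
    digits increase in [M], so finite type makes the limiting digits vanish from
    some position on: [a i] is eventually a constant plus a digit sum that is
    supported arbitrarily far out. *)
Lemma digit_sums_constant_part : exists c, forall n, \forall i \near F,
  digit_sums (a i - c) /\ (b%:Z ^+ n %| a i - c)%Z.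
Proof.
have [p pP] : {p : I -> {poly int} | \forall i \near F,
    [/\ forall j, dig (p i)`_j, a i = (p i).[b]
      & lab M (support_vector D (p i))]}.
  pose expands i := [set p : {poly int} | (forall j, dig p`_j) /\ a i = p.[b]].
  pose p i := xget 0 (expands i).
  exists p; apply: filterS aM => i [[q dq aq] Mi].
  have [dp ap] : (forall j, dig (p i)`_j) /\ a i = (p i).[b].
    exact: (@xgetI _ 0 (expands i) q).
  by split=> //; rewrite -(rvecE b_ge5) -?ap//; exact: dig_digits.
have /boolp.choice[e eP] j : exists c, \forall i \near F, (p i)`_j = c.
  have [F0|F0] := in_ultra_setVsetC [set i | (p i)`_j = 0] FU.
    by exists 0.
  have [F1|F1] := in_ultra_setVsetC [set i | (p i)`_j = 1] FU.
    by exists 1.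
  exists (-1); apply: filterS3 pP F0 F1 => i [/dig_digits/(_ j) dp _ _] /=.
  move=> n0 n1.
  by move: dp n0 n1; move: (p i)`_j => x; clear; lia.
pose q n := \poly_(j < n) e j.
have pq n : \forall i \near F, take_poly n (p i) = q n.
  have : \forall i \near F, forall j : 'I_n, (p i)`_j = e j.
    by apply: filter_forall => j; exact: eP.
  apply: filterS => i ie; apply/polyP => j; rewrite coef_take_poly coef_poly.
  by case: ifP => // jn; exact: (ie (Ordinal jn)).
have [n0 e0] : exists n0, forall j, (n0 <= j)%N -> e j = 0.
  apply: contrapT => no; apply: M_fin.
  have /boolp.choice[g gP] n : exists j, (n <= j)%N /\ e j != 0.
    apply: contrapT => non; apply: no; exists n => j nj.
    by apply/eqP; apply: contrapT => /negP ej; apply: non; exists j.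
  pose h n := iter n (fun n => (g n).+1) 0%N.
  have qS n : support_vector D (q n.+1) = support_vector D (q n) +
      (if e n == 0 then 0 else unit_vector (block D n)).
    have take_q k m : (k <= m)%N -> take_poly k (q m) = q k.
      move=> km; apply/polyP => j; rewrite coef_take_poly !coef_poly.
      by case: ifP => // jk; rewrite (leq_trans jk km).
    rewrite -{1}[q n.+1](take_q _ n.+1)// support_vector_take take_q//.
    by rewrite coef_poly ltnSn.
  have vle_trans u v w : vle u v -> vle v w -> vle u w.
    by move=> uv vw l; exact: leq_trans (uv l) (vw l).
  have qle n m : (n <= m)%N ->
      vle (support_vector D (q n)) (support_vector D (q m)).
    move=> /subnK <-; elim: (m - n)%N => [//|k IHk].
    by apply: vle_trans IHk _; rewrite addSn qS; exact: vle_addr.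
  (* [h] jumps from each nonzero limiting digit past the next one. *)
  exists (fun n => support_vector D (q (h n))) => n; split.
    have [i [pqi [dp ap Mi]]] := filter_ex (filterI (pq (h n)) pP).
    apply: lab_down Mi; rewrite -pqi.
    rewrite -{2}(poly_take_drop (h n) (p i)) support_vectorD.
      exact: vle_addr.
    move=> j; rewrite coef_take_poly coefMXn.
    by case: ltnP; [right|left].
  have [hg eg] := gP (h n); split; first by apply: qle; rewrite ltnW.
  have := qle _ _ hg; rewrite [h n.+1]/= qS (negbTE eg).
  set u := support_vector D (q (h n)); set v := support_vector D _.
  move=> /(_ (block D (g (h n)))) uv e1; move: uv.
  by rewrite e1 NvecD unit_vectorE eqxx addn1 ltnn.
have qE n : (n0 <= n)%N -> q n = q n0.
  move=> n0n; apply/polyP => j; rewrite !coef_poly.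
  case: (ltnP j n0) => [jn0|/e0 ->]; first by rewrite (leq_trans jn0 n0n).
  by case: ifP.
exists (q n0).[b] => n; pose k := maxn n n0.
apply: filterS2 (pq k) pP => i; rewrite qE ?leq_maxr// => pk [dp -> _].
rewrite -{1 2}(poly_take_drop k (p i)) pk hornerD addrC addKr.
split; last first.
  rewrite hornerM hornerXn dvdz_mull//; apply/dvdzP.
  by exists (b%:Z ^+ (k - n)); rewrite -exprD subnK// leq_maxl.
exists (drop_poly k (p i) * 'X^k) => // j.
by rewrite coefMXn; case: ltnP => // kj; rewrite coef_drop_poly subnK.
Qed.

End KeyLemma.
End DigitSets.

(** * The sets of the labels as sets of digit sums *)

Section Identification.
Context (b : nat) (b_ge5 : (5 <= b)%N).
Context (D : nat -> set nat) (D_part : partition_of_N D).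
Local Notation "p .[b]" := (horner p b%:Z) (at level 2, format "p .[b]").

Definition signed_digit : pred int := [pred c | `|c| <= 1].
Definition binary_digit : pred int := [pred c | (c == 0) || (c == 1)].

Lemma signed_digitP (c : int) : signed_digit c -> c <> 0 -> c = 1 \/ c = -1.
Proof. by rewrite /signed_digit /=; lia. Qed.

Lemma binary_digit_signed (c : int) : binary_digit c -> signed_digit c.
Proof. by move=> /orP[] /eqP ->. Qed.

Lemma k_signed n (c : int) : signed_digit c -> c <> 0 ->
  k b (c * n.+1%:Z) = c * b%:Z ^+ n.
Proof.
by move=> cd /(signed_digitP cd)[] ->;
  rewrite ?mulN1r ?kN ?mul1r/= posz_exp.
Qed.

(** Each nonzero digit [f i] contributes the index [f i * (i + 1)], and the
    positions are listed from the highest to the lowest. *)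
Lemma exists_expansion (f : nat -> int) n : (forall i, signed_digit (f i)) ->
  exists2 s, [/\ sorted (fun i j => `|j| < `|i|)%N s,
                all (fun j => 0 < `|j| <= n)%N s
              & \sum_(i < n) f i * b%:Z ^+ i = \sum_(j <- s) k b j] &
    forall l, count (fun j : int => `|j|%N \in D l) s =
      (\sum_(i < n | f i != 0) (i.+1 \in D l))%N.
Proof.
move=> f1; elim: n => [|n [s [ss sn fs] sc]].
  by exists nil => [|l]; rewrite !big_ord0//=; split; rewrite // big_nil.
have [f0|f0] := eqVneq (f n) 0.
  exists s; [split=> //|move=> l].
  - by apply: sub_all sn => j /andP[-> /leqW].
  - by rewrite big_ord_recr /= f0 mul0r addr0.
  by rewrite big_mkcond big_ord_recr /= f0 eqxx addn0 -big_mkcond /= sc.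
have fn0 : f n <> 0 by exact/eqP.
have jn : `|(f n * n.+1%:Z)%R|%N = n.+1.
  by have [->|->] := signed_digitP (f1 n) fn0; lia.
exists (f n * n.+1%:Z :: s); [split|move=> l].
- rewrite /= path_sortedE ?ss ?andbT; last first.
    by move=> x y z xy yz; exact: ltn_trans yz xy.
  by apply: sub_all sn => j /andP[_ jn']; rewrite jn ltnS.
- by rewrite /= jn leqnn/=; apply: sub_all sn => j /andP[-> /leqW].
- rewrite big_ord_recr big_cons /= fs k_signed//.
  by rewrite addrC.
by rewrite /= jn big_mkcond big_ord_recr /= f0 -big_mkcond /= sc addnC.
Qed.

Lemma expansion_polynomial t s : expansion b t s ->
  exists2 p : {poly int}, unit_digits p & t = p.[b] /\
    forall l, support_vector D p l = count (fun j : int => `|j|%N \in D l) s.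
Proof.
case=> ss s0 ->.
(* The bound on the size keeps the leading term apart from the other ones. *)
suff : exists2 p : {poly int},
    unit_digits p /\
    (forall n, all (fun j => `|j| <= n)%N s -> (size p <= n)%N) &
    \sum_(j <- s) k b j = p.[b] /\
    forall l, support_vector D p l = count (fun j : int => `|j|%N \in D l) s.
  by case=> p [? ?]; exists p.
elim: s ss s0 => [|j s IHs] /= ss.
  move=> _; exists 0; [split=> [i|n _]; rewrite ?coef0 ?size_poly0//|].
  split=> [|l]; rewrite ?big_nil ?horner0//.
  by rewrite /support_vector size_poly0 big_ord0 Nvec0.
move=> /andP[j0 s0].
have tr : transitive (fun i j : int => `|j| < `|i|)%N.
  by move=> x y z xy yz; exact: ltn_trans yz xy.
move: ss; rewrite path_sortedE// => /andP[js /IHs/(_ s0)[p [p1 ps] [sp pc]]].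
pose n := `|j|.-1%N; have jn : `|j|%N = n.+1 by rewrite prednK.
have pn : (size p <= n)%N.
  by apply: ps; apply: sub_all js => i; rewrite jn ltnS.
pose c : int := Num.sg j.
have c0 : c != 0 by rewrite sgr_eq0 -absz_eq0 -lt0n.
have cd : signed_digit c by rewrite /signed_digit /= normr_sg; case: (_ != _).
have jE : j = c * n.+1%:Z by rewrite -jn {1}[j]intEsg.
have disj i : p`_i = 0 \/ (c *: 'X^n)`_i = 0.
  have [->|i_n] := eqVneq i n; [by left; exact: nth_default|right].
  by rewrite coefZ coefXn (negbTE i_n) mulr0.
exists (p + c *: 'X^n).
  split=> [i|m /andP[jm _]].
    rewrite coefD; have [->|->] := disj i; last by rewrite (addr0 p`_i).
    rewrite add0r coefZ coefXn.
    by case: eqP => _; rewrite ?mulr1 ?mulr0 ?normr0.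
  rewrite (leq_trans (size_polyD _ _))// geq_max (leq_trans pn); last first.
    by rewrite ltnW// -jn.
  by rewrite (leq_trans (size_scale_leq _ _))// size_polyXn -jn.
split=> [|l].
  rewrite big_cons sp hornerD hornerZ hornerXn addrC.
  by rewrite [in LHS]jE k_signed//; exact/eqP.
rewrite support_vectorD// NvecD support_vectorXn// unit_vectorE pc addnC.
by rewrite (blockE D_part) jn.
Qed.

Lemma unit_digits_expansion p : unit_digits p ->
  exists2 s, expansion b p.[b] s &
    forall l, count (fun j : int => `|j|%N \in D l) s = support_vector D p l.
Proof.
move=> p1; have [s [ss sn ps] sc] := exists_expansion (size p) p1.
exists s; first split=> //.
- by apply: sub_all sn => j /andP[].
- by rewrite -ps horner_coef.
move=> l; rewrite sc /support_vector Nvec_sumE; apply: eq_bigr => i _.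
by rewrite unit_vectorE (blockE D_part).
Qed.

Lemma length_vectorE t : digit_sums b signed_digit t ->
  length_vector b D t = rvec b D t.
Proof.
move=> [p p1 ->]; rewrite rvecE//.
have [s ps sc] := unit_digits_expansion p1.
apply: xget_unique => [|r [s' /expansion_polynomial[q q1 [pq qc]] rc]].
  by exists s.
have qp : q = p by apply: (unit_digits_inj b_ge5).
by apply: NvecP => l; rewrite rc -qc qp.
Qed.

Lemma finite_sums_digit_sums (dig : pred int) (B : set int) :
  (forall c, dig c -> signed_digit c) ->
  (forall c n, dig c -> c != 0 -> B (c * b%:Z ^+ n)) ->
  digit_sums b dig `<=` finite_sums B.
Proof.
move=> dig1 digB _ [p dp ->]; rewrite horner_coef.
have b0 : 0 < b%:Z by rewrite ltz_nat (leq_trans _ b_ge5).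
have b1 : 1 < b%:Z by rewrite ltz_nat (leq_trans _ b_ge5).
(* The bound on the summands makes the one added last a new element. *)
suff [G [GB _ ->]] : exists G : {fset int}, [/\ [set` G] `<=` B,
    forall a, a \in G -> `|a| < b%:Z ^+ size p
    & \sum_(i < size p) p`_i * b%:Z ^+ i = \sum_(a <- G) a].
  by exists G.
elim: (size p) => [|n [G [GB Gn pG]]].
  exists fset0; split=> [a|a|]; rewrite /= ?inE//.
  by rewrite big_ord0 big_seq_fset0.
have bn : b%:Z ^+ n < b%:Z ^+ n.+1 by rewrite ltr_eXn2l.
rewrite big_ord_recr /= pG; have [pn0|pn0] := eqVneq p`_n 0.
  exists G; split=> // [a /Gn an|]; first exact: lt_trans bn.
  by rewrite pn0 mul0r addr0.
have cn : `|p`_n * b%:Z ^+ n| = b%:Z ^+ n.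
  have /eqP pn := pn0; rewrite normrM (gtr0_norm (exprn_gt0 n b0)).
  have [->|->] := signed_digitP (dig1 _ (dp n)) pn;
    by rewrite ?normrN1 ?normr1 mul1r.
exists (p`_n * b%:Z ^+ n |` G)%fset; split=> [a|a|].
- by rewrite /= !inE => /orP[/eqP ->|/GB//]; exact: digB.
- by rewrite !inE => /orP[/eqP ->|/Gn an]; [rewrite cn|exact: lt_trans bn].
- rewrite big_fsetU1 1?addrC//=; apply/negP => /Gn.
  by rewrite cn ltxx.
Qed.

(** Summands [b ^ i] and [- b ^ i] may both occur and then cancel: the digit at
    [i] is the difference of their indicators. *)
Lemma digit_sums_finite_sums (dig : pred int) (B : set int) :
  dig 0 -> dig 1 -> (forall i, B (- b%:Z ^+ i) -> dig (-1)) ->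
  B `<=` range (k b) -> finite_sums B `<=` digit_sums b dig.
Proof.
move=> dig0 dig1 digN Bk _ [G GB ->].
have b0 : 0 < b%:Z by rewrite ltz_nat (leq_trans _ b_ge5).
have b1 : b%:Z != 1 by rewrite gt_eqF// ltz_nat (leq_trans _ b_ge5).
have bX := posz_exp b.
have bX0 i : 0 < b%:Z ^+ i by rewrite exprn_gt0.
have bN i j : (b%:Z ^+ i == - b%:Z ^+ j) = false.
  by rewrite gt_eqF// (lt_trans _ (bX0 i))// oppr_lt0.
have bI i j : (b%:Z ^+ i == b%:Z ^+ j) = (i == j).
  by apply/eqP/eqP => [/ieexprIn|->//]; apply.
pose n := (\max_(a <- G) `|a|%N).+1.
have Gn i : b%:Z ^+ i \in G \/ - b%:Z ^+ i \in G -> (i < n)%N.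
  move=> Gi; rewrite /n ltnS.
  have bi : (i <= `|b%:Z ^+ i|)%N.
    by rewrite -bX absz_nat ltnW// ltn_expl// (leq_trans _ b_ge5).
  apply: leq_trans bi _; case: Gi => Gi; last rewrite -abszN.
    exact: (leq_bigmax_seq (F := absz)).
  exact: (leq_bigmax_seq (F := absz)).
pose c i : int := (b%:Z ^+ i \in G)%:Z - (- b%:Z ^+ i \in G)%:Z.
exists (\poly_(i < n) c i) => [i|].
  rewrite coef_poly; case: ifP => // _; rewrite /c.
  case: (boolP (- b%:Z ^+ i \in G)) => [/GB/digN digN1|_].
    by case: (_ \in G); rewrite ?subrr// sub0r.
  by rewrite subr0; case: (_ \in G).
have cE i : c i = \sum_(a <- G) ((b%:Z ^+ i == a)%:Z - (- b%:Z ^+ i == a)%:Z).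
  have memE x : (x \in G)%:Z = \sum_(a <- G) (x == a)%:Z.
    have [xG|xG] := boolP (x \in G).
      rewrite (big_fsetD1 x)//= eqxx big1_fset ?addr0// => a.
      by rewrite !inE => /andP[ax _] _; rewrite eq_sym (negbTE ax).
    rewrite big1_fset// => a aG _; case: eqP => // xa.
    by rewrite xa aG in xG.
  by rewrite sumrB -!memE.
rewrite horner_poly; under [RHS]eq_bigr => i _ do rewrite cE mulr_suml.
rewrite [RHS]exchange_big /=; apply: eq_big_seq => a aG.
have [j _ ja] := Bk _ (GB _ aG).
have [a0|[m am]] : a = 0 \/ exists m, a = b%:Z ^+ m \/ a = - b%:Z ^+ m.
  case: j ja => [[|j]|j] /= <-; first by left.
    by right; exists j; left.
  by right; exists j; right; rewrite bX.
  rewrite a0 big1// => i _; rewrite (gt_eqF (bX0 i)).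
  by rewrite oppr_eq0 (gt_eqF (bX0 i)) subrr mul0r.
have mn : (m < n)%N by apply: Gn; case: am aG => -> ->; [left|right].
rewrite (bigD1 (Ordinal mn))//= big1 ?addr0.
  case: am => ->; rewrite ?eqxx ?bN ?eqr_opp ?eqxx.
    by rewrite eq_sym bN subr0 mul1r.
  by rewrite sub0r mulN1r.
move=> i; rewrite -val_eqE /= => im; case: am => ->.
  by rewrite bI (negbTE im) eq_sym bN mul0r.
by rewrite bN eqr_opp bI (negbTE im) mul0r.
Qed.

Lemma IPE : IP b = digit_sums b signed_digit.
Proof.
apply/seteqP; split; first exact: digit_sums_finite_sums.
apply: finite_sums_digit_sums => // c n c1 /eqP c0.
by exists (c * n.+1%:Z) => //; exact: k_signed.
Qed.

Lemma IPplusE : IPplus b = digit_sums b binary_digit.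
Proof.
have bX := posz_exp b.
have b0 i : 0 < b%:Z ^+ i by rewrite exprn_gt0// ltz_nat (leq_trans _ b_ge5).
apply/seteqP; split.
  apply: digit_sums_finite_sums => //; last by move=> _ [j _ <-]; exists j.
  move=> i [[j|//] _ kj]; have := b0 i; rewrite -oppr_lt0 -kj.
  by case: j kj.
apply: finite_sums_digit_sums; first exact: binary_digit_signed.
move=> c n /orP[/eqP ->|/eqP -> _]; first by rewrite eqxx.
by exists n.+1%:Z => //=; rewrite mul1r -bX.
Qed.

(** Both families of configurations, x[N] and x_+[N], are of this form. *)
Definition digit_config (dig : pred int) (N : label) : config :=
  fun t => `[< digit_sums b dig t /\ lab N (rvec b D t) >].

Lemma xlabE : xlab b D = digit_config signed_digit.
Proof.
apply/funext => N; apply/funext => t; apply/idP/asboolP => [/set_mem[]|[Jt Nt]].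
  by rewrite IPE => Jt Nt; rewrite -length_vectorE.
by apply/mem_set; split; [rewrite IPE|rewrite length_vectorE].
Qed.

Lemma xplusE : xplus b D = digit_config binary_digit.
Proof.
have sub : digit_sums b binary_digit `<=` digit_sums b signed_digit.
  by move=> t [p dp tp]; exists p => // i; exact: binary_digit_signed.
apply/funext => N; apply/funext => t; apply/idP/asboolP => [/set_mem[]|[Jt Nt]].
  by rewrite IPplusE => -[_ Nt] Jt; rewrite -length_vectorE//; exact: sub.
apply/mem_set; split; last by rewrite IPplusE.
by split; [rewrite IPE|rewrite length_vectorE//]; exact: sub.
Qed.

End Identification.

(** * Labels along filters *)

Definition to_set_type (T : Type) (A : set T) (z : T) (Az : A z) : A :=
  exist (fun z => z \in A) z (mem_set Az).

Section ThetaLimits.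
Context (M : label).

Lemma ThetaP N : Theta M N -> exists2 F : set_system Nvec, UltraFilter F &
  forall m, \forall r \near F, lab M (m + r) <-> lab N m.
Proof.
move=> /(@closure_rangeP label Nvec (P ^~ M) N)[F FU FN]; exists F => // m.
by move/cvg_label: FN => /(_ m).
Qed.

Lemma Theta_sub N : Theta M N -> lab N `<=` lab M.
Proof.
move=> /ThetaP[F FU FN] m Nm; have [r rm] := filter_ex (FN m).
exact: lab_down (vle_addr m r) (rm.2 Nm).
Qed.

Lemma Theta_P N r : Theta M N -> Theta M (P r N).
Proof. exact: P_Theta. Qed.

Lemma Theta_cvg (I : Type) (F : set_system I) {FF : ProperFilter F}
    (L : I -> label) N :
  (forall i, Theta M (L i)) ->
  (forall m, \forall i \near F, lab (L i) m <-> lab N m) -> Theta M N.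
Proof.
move=> ML /cvg_label LN.
by apply: (@closed_cvg _ _ F FF L (Theta M) _ _ N LN);
  [exact: closed_closure|exact: nearW].
Qed.

Lemma ETheta_intro (F : set_system Nvec) (FF : ProperFilter F)
    (Q : {ptws Theta M -> Theta M}) :
  (forall (N : Theta M) m,
     \forall r \near F, lab (val N) (m + r) <-> lab (val (Q N)) m) ->
  ETheta M Q.
Proof.
move=> FQ.
apply: (@closure_range_proper {ptws Theta M -> Theta M} _ _ _ F) => //.
apply/cvg_ptws => N; apply/cvg_set_type/cvg_label => m; exact: FQ.
Qed.

Lemma ETheta_elim (Q : {ptws Theta M -> Theta M}) : ETheta M Q ->
  exists2 F : set_system Nvec, UltraFilter F &
    forall (N : Theta M) m,
      \forall r \near F, lab (val N) (m + r) <-> lab (val (Q N)) m.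
Proof.
move=> /(@closure_rangeP {ptws Theta M -> Theta M} _ _ _)[F FU FQ].
exists F => // N m; move/cvg_ptws: FQ => /(_ N)/cvg_set_type/cvg_label; exact.
Qed.

Lemma ETheta_P r : ETheta M (P_on M r).
Proof. by apply: subset_closure; exists r. Qed.

Context (M_fin : finite_type M).

(** The labels in the orbit closure are subsets of [M], so a translation by a
    vector outside of [M] empties all of them. *)
Lemma P_eq_label0 : exists r, forall N, Theta M N -> P r N = label0.
Proof.
have [r Mr] := finite_type_proper M_fin; exists r => N NM.
apply: labelP; apply/seteqP; split=> //= m mN; apply: Mr.
have := Theta_sub NM mN; apply: lab_down; rewrite addrC; exact: vle_addr.
Qed.

Lemma Theta_label0 : Theta M label0.
Proof.
have [r rM] := P_eq_label0.
have MM : Theta M M by apply: subset_closure; exists 0; rewrite ?P0.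
by rewrite -(rM M MM); exact: Theta_P.
Qed.

End ThetaLimits.

(** The limit of a family of labels along an ultrafilter: it always exists,
    which is the compactness of the space of labels. *)
Section UltraLimit.
Context (I : Type) (F : set_system I) {FU : UltraFilter F} (L : I -> label).

Lemma ulim_down m m1 : vle m1 m ->
  (\forall i \near F, lab (L i) m) -> \forall i \near F, lab (L i) m1.
Proof. by move=> mm; apply: filterS => i; exact: lab_down. Qed.

Definition ulim : label := Label ulim_down.

Lemma ulimP m : \forall i \near F, lab (L i) m <-> lab ulim m.
Proof. exact: ultra_near_iff. Qed.

End UltraLimit.
Arguments ulim {I} F {FU} L.
Arguments ulimP {I} F {FU} L m.

Section ES_filters.
Context (x : config).

Lemma ES_intro (F : set_system int) (FF : ProperFilter F)
    (q : {ptws X x -> X x}) :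
  (forall (z : X x) s, \forall t \near F, val z (s + t) = val (q z) s) ->
  ES x q.
Proof.
move=> Fq; apply: (@closure_range_proper {ptws X x -> X x} _ _ _ F) => //.
apply/cvg_ptws => z; apply/cvg_set_type/cvg_config => s; exact: Fq.
Qed.

Lemma ES_elim (q : {ptws X x -> X x}) : ES x q ->
  exists2 F : set_system int, UltraFilter F &
  forall (z : X x) s, \forall t \near F, val z (s + t) = val (q z) s.
Proof.
move=> /(@closure_rangeP {ptws X x -> X x} _ _ _)[F FU Fq].
exists F => // z s; move/cvg_ptws: Fq => /(_ z)/cvg_set_type/cvg_config; exact.
Qed.

(** Each element of the enveloping semigroup is a pointwise limit of powers of
    the shift, and so commutes with the shift. *)
Lemma ES_shift (q : {ptws X x -> X x}) (z z' : X x) a : ES x q ->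
  val z = shiftz a (val z') -> val (q z) = shiftz a (val (q z')).
Proof.
move=> /ES_elim[F FU Fq] zz'; apply/funext => s.
have [t [e1 e2]] := filter_ex (filterI (Fq z s) (Fq z' (s + a))).
by rewrite -e1 zz' /shiftz -e2 addrAC.
Qed.

End ES_filters.

(** * Configurations at deep times *)

Section LabeledSubshift.
Context (b : nat) (b_ge5 : (5 <= b)%N).
Context (D : nat -> set nat) (D_part : partition_of_N D).
Context (dig : pred int) (dig0 : dig 0) (dig1 : dig 1)
  (dig_unit : forall c, dig c -> `|c| <= 1).
Local Notation J := (digit_sums b dig).
Local Notation rv := (rvec b D).
Local Notation x := (digit_config b D dig).

(** Divisibility by [b ^ n] says that the first [n] digits vanish. *)
Definition deep n (t : int) := J t /\ (b%:Z ^+ n %| t)%Z.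

(** This is where a shift of a configuration turns into the translation of its
    label by a vector. *)
Lemma x_deep n t N s : deep n t -> 2 * `|s| < b%:Z ^+ n ->
  x N (s + t) = x (P (rv t) N) s.
Proof.
move=> [Jt tn] sn.
have [JJ rD] := digit_sums_deepD b_ge5 D dig0 dig_unit Jt tn sn.
apply/asboolP/asboolP => -[Js Ns]; split.
- exact/JJ.
- by rewrite /= -rD//; exact/JJ.
- exact/JJ.
- by rewrite rD.
Qed.

Lemma x_sub N1 N2 t : lab N1 `<=` lab N2 -> x N1 t -> x N2 t.
Proof. by move=> N12 /asboolP[Jt /N12 Nt]; exact/asboolP. Qed.

Lemma x_label0 : x label0 = e_fix.
Proof. by apply/funext => t; apply/asboolP => -[]. Qed.

Lemma x_at0 N : lab N 0 -> x N 0.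
Proof.
by move=> N0; apply/asboolP; rewrite rvec0//; split=> //; exact: digit_sums0.
Qed.

Lemma x_inj : injective x.
Proof.
move=> N1 N2 N12; apply: labelP; apply/seteqP.
split=> m Nm; have [t [Jt _ tm]] :=
    digit_sums_deep_rvec b_ge5 D_part dig0 dig1 dig_unit m 0.
  have : x N1 t by apply/asboolP; rewrite tm.
  by rewrite N12 => /asboolP[_]; rewrite tm.
have : x N2 t by apply/asboolP; rewrite tm.
by rewrite -N12 => /asboolP[_]; rewrite tm.
Qed.

Lemma pow_b_unbounded (s : int) : exists n, 2 * `|s| < b%:Z ^+ n.
Proof.
exists (2 * `|s|)%N; rewrite -posz_exp -abszE -PoszM ltz_nat ltn_expl//.
exact: leq_trans b_ge5.
Qed.

(** The window in which the configuration of [L i] seen from [t i] agrees with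
    that of [L i - r(t i)] grows with the depth of [t i]. *)
Lemma x_deep_cvg (I : Type) (F : set_system I) {FF : Filter F}
    (t : I -> int) (L : I -> label) N s :
  (forall n, \forall i \near F, deep n (t i)) ->
  (forall m, \forall i \near F, lab (L i) (m + rv (t i)) <-> lab N m) ->
  \forall i \near F, x (L i) (s + t i) = x N s.
Proof.
move=> Ft FL; have [n sn] := pow_b_unbounded s.
apply: filterS2 (Ft n) (FL (rv s)) => i ti Li; rewrite (x_deep _ ti sn).
by apply/asboolP/asboolP => -[Js /Li].
Qed.

(** Times can be chosen with prescribed length vector and arbitrary depth, so a
    filter of vectors lifts to a filter of deeper and deeper times. *)
Lemma deep_filter (G : set_system Nvec) (GG : ProperFilter G) :
  exists F : set_system int, [/\ ProperFilter F,
    forall n, \forall t \near F, deep n t &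
    forall B : set Nvec, G B -> \forall t \near F, B (rv t)].
Proof.
have /boolp.choice[tau tauP] (rn : Nvec * nat) :
    exists t, deep rn.2 t /\ rv t = rn.1.
  have [t [Jt tn rt]] :=
    digit_sums_deep_rvec b_ge5 D_part dig0 dig1 dig_unit rn.1 rn.2.
  by exists t.
exists (tau @ filter_prod G \oo); split.
- exact: fmap_proper_filter.
- move=> n; exists (setT, [set m | (n <= m)%N]) => /=.
    by split; [exact: filterT|exists n].
  move=> [r m] [_ /= nm]; have [[Jt tm] _] := tauP (r, m).
  split=> //; apply: dvdz_trans tm; apply/dvdzP.
  by exists (b%:Z ^+ (m - n)); rewrite -exprD subnK.
- move=> B GB; exists (B, setT) => /=; first by split=> //; exact: filterT.
  by move=> [r m] [/= Br _]; rewrite /preimage /= (tauP (r, m)).2.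
Qed.

Context (M : label) (M_fin : finite_type M).
Local Notation XM := (X (x M)).

Lemma x_in_X N : Theta M N -> XM (x N).
Proof.
move=> /ThetaP[G GU GN]; have [F [FF Ft FG]] := deep_filter ultra_proper.
apply: (@closure_range_proper config _ _ _ F) => //; apply/cvg_config => s.
exact: (x_deep_cvg (L := fun=> M) s Ft (fun m => FG _ (GN m))).
Qed.

Lemma deep_part (I : Type) (F : set_system I) {FU : UltraFilter F}
    (a : I -> int) (L : I -> label) :
  (forall i, Theta M (L i)) -> (\forall i \near F, x (L i) (a i)) ->
  exists c, forall n, \forall i \near F, deep n (a i - c).
Proof.
move=> LM La; apply: (digit_sums_constant_part b_ge5 dig0 dig_unit M_fin).
apply: filterS La => i /asboolP[Ja Na]; split=> //.
exact: Theta_sub Na.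
Qed.

(** A value 1 at a fixed place makes the shifts digit sums up to a translation,
    and then they are a constant [c] plus deep times. The limit is therefore
    the configuration, shifted by [c], of a limit of translated labels. *)
Lemma ultra_shift_limit (I : Type) (F : set_system I) {FU : UltraFilter F}
    (a : I -> int) (L : I -> label) s0 :
  (forall i, Theta M (L i)) -> (\forall i \near F, x (L i) (s0 + a i)) ->
  exists c, (forall n, \forall i \near F, deep n (a i - c)) /\
    let N := ulim F (fun i => P (rv (a i - c)) (L i)) in
    Theta M N /\ forall s, \forall i \near F, x (L i) (s + a i) = x N (s + c).
Proof.
move=> LM La; have [c0 c0P] := deep_part LM La.
exists (c0 - s0).
have cP n : \forall i \near F, deep n (a i - (c0 - s0)).
  by apply: filterS (c0P n) => i; rewrite opprB addrA [a i + s0]addrC.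
split=> //=; split.
  apply: (@Theta_cvg M I F _ _ _ _ (ulimP F _)) => i.
  exact/Theta_P/LM.
move=> s; set c := c0 - s0; set N := ulim _ _.
have xs : \forall i \near F, x (L i) (s + c + (a i - c)) = x N (s + c).
  apply: x_deep_cvg cP _ => m.
  exact: (ulimP F (fun i => P (rv (a i - c)) (L i))).
by apply: filterS xs => i <-; rewrite -addrA [c + _]addrC subrK.
Qed.

(** A point other than the fixed one has a value 1, to which the description of
    limits applies; the fixed point is the configuration of the empty label. *)
Lemma X_shift_form z : XM z -> exists aN : int * Theta M,
  z = shiftz aN.1 (x (val aN.2)).
Proof.
move=> /(@closure_rangeP config int (shiftz ^~ (x M)) z)[F FU /cvg_config Fz].
have [ze|/existsNP[s0 zs0]] := pselect (forall s, z s = false).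
  exists (0, to_set_type (Theta_label0 M_fin)) => /=.
  by rewrite x_label0 shiftz0; apply/funext.
have MM : Theta M M by apply: subset_closure; exists 0; rewrite ?P0.
have zF : \forall t \near F, x M (s0 + t).
  apply: filterS (Fz s0) => t zt; change (is_true (shiftz t (x M) s0)).
  by rewrite zt; move: zs0; case: (z s0).
have [c [_ [NM Nz]]] := @ultra_shift_limit _ F FU id (fun=> M) s0 (fun=> MM) zF.
exists (c, to_set_type NM); apply/funext => s /=.
have [i [xi zi]] := filter_ex (filterI (Nz s) (Fz s)).
by rewrite -zi; exact: xi.
Qed.

End LabeledSubshift.

(** * The enveloping semigroup of a labeled subshift *)

Section EnvelopingSemigroup.
Context (b : nat) (b_ge5 : (5 <= b)%N).
Context (D : nat -> set nat) (D_part : partition_of_N D).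
Context (dig : pred int) (dig0 : dig 0) (dig1 : dig 1)
  (dig_unit : forall c, dig c -> `|c| <= 1).
Context (M : label) (M_fin : finite_type M).
Local Notation rv := (rvec b D).
Local Notation x := (digit_config b D dig).
Local Notation XM := (X (x M)).
Local Notation Th := (Theta M).

Definition config_of (N : Th) : XM :=
  to_set_type (x_in_X b_ge5 D_part dig0 dig1 dig_unit (set_mem (valP N))).

Definition shift_form (z : XM) : int * Th :=
  projT1 (cid (X_shift_form b_ge5 dig0 dig_unit M_fin (set_mem (valP z)))).

Lemma shift_formE z :
  val z = shiftz (shift_form z).1 (x (val (shift_form z).2)).
Proof. by rewrite /shift_form; case: cid. Qed.

(** The map of configurations induced by a map of labels, defined on a chosen
    representation [S^a x[N]] of each point. *)
Definition config_map (Q : {ptws Th -> Th}) : {ptws XM -> XM} := fun z =>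
  S_on (x M) (shift_form z).1 (config_of (Q (shift_form z).2)).

Lemma val_config_map Q z :
  val (config_map Q z) = shiftz (shift_form z).1 (x (val (Q (shift_form z).2))).
Proof. by []. Qed.

(** An approximating filter of vectors is turned into one of deep times, along
    which the powers of the shift converge to the induced map. *)
Lemma config_map_filter Q : ETheta M Q ->
  exists2 F : set_system int, ProperFilter F &
    forall (N : Th) a s, \forall t \near F,
      x (val N) (s + t + a) = x (val (Q N)) (s + a).
Proof.
move=> /ETheta_elim[G GU GQ].
have [F [FF Ft FG]] :=
  deep_filter b_ge5 D_part dig0 dig1 dig_unit (ultra_proper (F := G)).
exists F => // N a s.
have xs : \forall t \near F, x (val N) (s + a + t) = x (val (Q N)) (s + a).
  apply: (x_deep_cvg b_ge5 (L := fun=> val N) dig0 dig_unit _ Ft) => m.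
  exact: (FG _ (GQ N m)).
by apply: filterS xs => t <-; rewrite addrAC.
Qed.

Lemma config_map_ES Q : ETheta M Q -> ES (x M) (config_map Q).
Proof.
move=> /config_map_filter[F FF FQ]; apply: (@ES_intro _ F) => z s.
rewrite val_config_map shift_formE; exact: FQ.
Qed.

(** The value is a limit of shifts of the point itself, so it is independent of
    the representation. *)
Lemma config_mapE Q z a (N : Th) : ETheta M Q ->
  val z = shiftz a (x (val N)) ->
  val (config_map Q z) = shiftz a (x (val (Q N))).
Proof.
move=> QE zN; have [F FF FQ] := config_map_filter QE.
rewrite val_config_map; set c := (shift_form z).1; set N' := (shift_form z).2.
apply/funext => s.
have [t [e1 e2]] := filter_ex (filterI (FQ N a s) (FQ N' c s)).
rewrite /shiftz -e1 -e2.
have := shift_formE z; rewrite zN => /(congr1 (fun y : config => y (s + t))).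
by rewrite /shiftz => ->.
Qed.

(** The elements commute with the shift and each point is a shift of some
    [x[N]]. *)
Lemma ES_ext q q' : ES (x M) q -> ES (x M) q' ->
  (forall N : Th, val (q (config_of N)) = val (q' (config_of N))) -> q = q'.
Proof.
move=> qE q'E qq'; apply/funext => z; apply: val_inj.
have zE : val z = shiftz (shift_form z).1 (val (config_of (shift_form z).2)).
  exact: shift_formE.
by rewrite (ES_shift qE zE) (ES_shift q'E zE) qq'.
Qed.

Lemma config_map_unique Q : ETheta M Q ->
  unique (fun q => ES (x M) q /\ intertwines x M Q q) (config_map Q).
Proof.
move=> QE; have QN N : val (config_map Q (config_of N)) = x (val (Q N)).
  by rewrite (@config_mapE Q (config_of N) 0 N QE) ?shiftz0.
split=> [|q [qE qQ]].
  by split=> [|N]; [exact: config_map_ES|exists (config_of N)].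
apply: ES_ext => // [|N]; first exact: config_map_ES.
by have [z zN qz] := qQ N; rewrite QN -qz; congr (val (q _)); apply: val_inj.
Qed.

Section ConstantMap.
Context (U : {ptws Th -> Th}) (U0 : forall N, val (U N) = label0).

Lemma val_config_mapU z : val (config_map U z) = e_fix.
Proof. by rewrite val_config_map U0 x_label0. Qed.

Lemma config_mapU_idem : config_map U \o config_map U = config_map U.
Proof.
apply/funext => z; apply: val_inj.
by rewrite [RHS]val_config_mapU; exact: val_config_mapU.
Qed.

Lemma neq_config_mapU q : q <> config_map U -> exists z s, val (q z) s = true.
Proof.
move=> qU; apply: contrapT => no; apply: qU; apply/funext => z; apply: val_inj.
rewrite val_config_mapU; apply/funext => s; apply/negbTE/negP => zs.
by apply: no; exists z, s.
Qed.

(** A value 1 of [q z] shows that the times converging to [q] are a constant [c]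
    plus deep times; the label map is the limit of the translations by the
    length vectors of the latter. *)
Lemma shifted_config_map_exists q : ES (x M) q -> q <> config_map U ->
  exists t Q, ETheta M Q /\ q = S_on (x M) t \o config_map Q.
Proof.
move=> qE /neq_config_mapU[z [s0 qzs]]; have [F FU Fq] := ES_elim qE.
have zE := shift_formE z; set a := (shift_form z).1 in zE *.
set N0 := (shift_form z).2 in zE *.
have Fx : \forall t \near F, x (val N0) (s0 + a + t).
  apply: filterS (Fq z s0) => t; rewrite qzs zE /shiftz => xt.
  by rewrite addrAC; exact: xt.
have [c [Fc _]] := ultra_shift_limit b_ge5 dig0 dig_unit M_fin
  (fun=> set_mem (valP N0)) Fx.
have QTh (N : Th) : Theta M (ulim F (fun t => P (rv (t - c)) (val N))).
  apply: (@Theta_cvg M int F _ _ _ _ (ulimP F _)) => t.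
  exact/Theta_P/(set_mem (valP N)).
pose Q : {ptws Th -> Th} := fun N => to_set_type (QTh N).
have QE : ETheta M Q.
  apply: (@ETheta_intro M ((fun t => rv (t - c)) @ F)) => N m.
  exact: (ulimP F (fun t => P (rv (t - c)) (val N)) m).
exists c, Q; split=> //; apply/funext => y; apply: val_inj; apply/funext => s.
have yE := shift_formE y.
rewrite -[RHS]/(val (config_map Q y) (s + c)) val_config_map /shiftz.
set a' := (shift_form y).1 in yE *; set N := (shift_form y).2 in yE *.
have FN : \forall t \near F,
    x (val N) (s + c + a' + (t - c)) = x (val (Q N)) (s + c + a').
  apply: (x_deep_cvg b_ge5 dig0 dig_unit) => // m.
  exact: (ulimP F (fun t => P (rv (t - c)) (val N)) m).
have [t [<- <-]] := filter_ex (filterI (Fq y s) FN).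
by rewrite yE /shiftz; congr (x _ _); ring.
Qed.

(** Equality of the shifted configurations first yields that [d] and [- d] are
    digit sums, the latter in the set of [N1]. Both have the same length vector,
    so [d] is in this set as well, and shifting it once more gives [2 d]. *)
Lemma x_shift_inj (N1 N2 : label) d :
  lab N1 0 -> (forall s, x N1 s = x N2 (s + d)) -> d = 0.
Proof.
move=> N10 N12.
have x1 := x_at0 b_ge5 D dig0 N10.
have : x N2 d by rewrite -[d]add0r -N12.
move=> /asboolP[Jd Nd].
have N20 : lab N2 0 by apply: lab_down Nd => l; rewrite Nvec0.
have : x N1 (- d) by rewrite N12 addNr; exact: x_at0.
move=> /asboolP[JNd NNd].
have : x N1 d by apply/asboolP; split=> //; rewrite -(rvecN b_ge5 D dig_unit).
rewrite N12 => /asboolP[Jdd _].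
apply: oppr_inj; rewrite oppr0.
by apply: (digit_sumsN_eq0 b_ge5 dig_unit); rewrite ?opprK.
Qed.

Lemma shifted_config_map_unique q t1 t2 Q1 Q2 : q <> config_map U ->
  ETheta M Q1 -> ETheta M Q2 ->
  q = S_on (x M) t1 \o config_map Q1 -> q = S_on (x M) t2 \o config_map Q2 ->
  t1 = t2 /\ Q1 = Q2.
Proof.
move=> qU Q1E Q2E q1 q2.
have xQ (N : Th) s : x (val (Q1 N)) (s + t1) = x (val (Q2 N)) (s + t2).
  have : shiftz t1 (val (config_map Q1 (config_of N))) =
         shiftz t2 (val (config_map Q2 (config_of N))).
    exact: (congr1 (fun q => val (q (config_of N))) (etrans (esym q1) q2)).
  have cN : val (config_of N) = shiftz 0 (x (val N)) by rewrite shiftz0.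
  rewrite (config_mapE Q1E cN) (config_mapE Q2E cN) !shiftz0.
  by move/(congr1 (fun y : config => y s)).
have tt : t1 = t2.
  have [z [s zs]] := neq_config_mapU qU; move: zs.
  rewrite q1 -[LHS]/(val (config_map Q1 z) (s + t1)) val_config_map /shiftz.
  set N := (shift_form z).2 => /asboolP[_ NQ].
  have N0 : lab (val (Q1 N)) 0 by apply: lab_down NQ => l; rewrite Nvec0.
  apply/eqP; rewrite eq_sym -subr_eq0; apply/eqP.
  apply: (@x_shift_inj (val (Q1 N)) (val (Q2 N))) => // s'.
  by rewrite -[s' in LHS](subrK t1) xQ; congr (x _ _); ring.
split=> //; apply/funext => N; apply: val_inj.
apply: (x_inj b_ge5 D_part dig0 dig1 dig_unit); apply/funext => s.
by have := xQ N (s - t1); rewrite -tt subrK.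
Qed.

Lemma shifted_config_map_exists_unique q : ES (x M) q -> q <> config_map U ->
  exists! tQ : int * {ptws Th -> Th},
    ETheta M tQ.2 /\ q = S_on (x M) tQ.1 \o config_map tQ.2.
Proof.
move=> qE qU; have [t [Q [QE qQ]]] := shifted_config_map_exists qE qU.
exists (t, Q); split=> // -[t' Q'] [/= Q'E qQ'].
by have [-> ->] := shifted_config_map_unique qU QE Q'E qQ qQ'.
Qed.

End ConstantMap.

Lemma P_lab_sub r N : lab (P r N) `<=` lab N.
Proof. by move=> m /=; apply: lab_down; exact: vle_addr. Qed.

(** Continuity is tested along an ultrafilter of configurations: either these
    take the value 1 at a fixed place, and then both they and their images
    converge as described by deep times, or they converge to the fixed point
    and so do their images, which lie below them. *)
Lemma config_map_P_continuous r : continuous (config_map (P_on M r) : XM -> XM).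
Proof.
move=> z; apply: continuous_ultra => F FU Fz.
have rE : ETheta M (P_on M r) by exact: ETheta_P.
have {}Fz s : \forall y \near F, val y s = val z s.
  by move/(@cvg_set_type _ F _ _ _ id z)/cvg_config : Fz; exact.
apply/cvg_set_type/cvg_config => s.
have below y t : val (config_map (P_on M r) y) t -> val y t.
  rewrite val_config_map [val y]shift_formE; apply: x_sub; exact: P_lab_sub.
have [[s0 zs0]|ze] := pselect (exists s0, val z s0).
  have Fx : \forall y \near F,
      x (val (shift_form y).2) (s0 + (shift_form y).1).
    by apply: filterS (Fz s0) => y; rewrite zs0 shift_formE.
  have [c [Fc [NTh Nx]]] := ultra_shift_limit b_ge5 dig0 dig_unit M_fin
    (fun y => set_mem (valP (shift_form y).2)) Fx.
  have zN : val z = shiftz c (x (val (to_set_type NTh))).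
    apply/funext => t; have [y [<- e]] := filter_ex (filterI (Fz t) (Nx t)).
    by rewrite shift_formE; exact: e.
  rewrite (config_mapE rE zN) /=.
  have FN : \forall y \near F,
      x (P r (val (shift_form y).2)) (s + c + ((shift_form y).1 - c)) =
      x (P r (val (to_set_type NTh))) (s + c).
    apply: (x_deep_cvg b_ge5 dig0 dig_unit) => // m /=.
    apply: filterS (ulimP F (fun y => P (rv ((shift_form y).1 - c))
      (val (shift_form y).2)) (m + r)) => y /=.
    by rewrite addrAC.
  apply: filterS FN => y yN.
  rewrite -[LHS]/(val (config_map (P_on M r) y) s) val_config_map /shiftz.
  rewrite -[RHS]yN.
  by congr (x _ _); ring.
have z0 t : val z t = false by apply/negbTE/negP => zt; apply: ze; exists t.
apply: filterS (Fz s) => y; rewrite z0 => ys.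
have below0 y' : val y' s = false -> val (config_map (P_on M r) y') s = false.
  by move=> ys'; apply/negbTE/negP => /below; rewrite ys'.
by rewrite !below0.
Qed.

Lemma config_map_P0 : config_map (P_on M 0) = id.
Proof.
apply/funext => z; apply: val_inj.
by rewrite val_config_map [RHS]shift_formE /= P0.
Qed.

Lemma config_map_PD r s :
  config_map (P_on M (r + s)) = config_map (P_on M r) \o config_map (P_on M s).
Proof.
apply/funext => z; apply: val_inj; rewrite val_config_map.
rewrite -[RHS]/(val (config_map (P_on M r) (config_map (P_on M s) z))).
by rewrite (config_mapE (@ETheta_P M r) (val_config_map _ z)) /= PD.
Qed.

Lemma config_map_P_action : continuous_action (fun r => config_map (P_on M r)).
Proof.
split; [exact: config_map_P0|exact: config_map_PD|].
move=> [r z] A /= /config_map_P_continuous zA.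
exists ([set r], config_map (P_on M r) @^-1` A) => /=.
  by split=> //; exact: discrete_set1.
by move=> [r' y] [/= -> ].
Qed.

End EnvelopingSemigroup.

Theorem theorem4p15 (b : nat) (b_odd : odd b) (b_ge5 : (5 <= b)%N)
    (D : nat -> set nat) (D_part : partition_of_N D)
    (M : label) (M_fin : finite_type M) :
  exists (U : {ptws Theta M -> Theta M})
    (u : {ptws X (xlab b D M) -> X (xlab b D M)})
    (u_plus : {ptws X (xplus b D M) -> X (xplus b D M)})
    (Dbar : {ptws Theta M -> Theta M} ->
            {ptws X (xlab b D M) -> X (xlab b D M)})
    (Dbar_plus : {ptws Theta M -> Theta M} ->
                 {ptws X (xplus b D M) -> X (xplus b D M)}),
  [/\ (* the constant maps U and u *)
      [/\ ETheta M U /\ (forall N, val (U N) = label0),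
          [/\ ES (xlab b D M) u, u \o u = u & forall z, val (u z) = e_fix]
        & [/\ ES (xplus b D M) u_plus, u_plus \o u_plus = u_plus
            & forall z, val (u_plus z) = e_fix]],
      (* (a) *)
      [/\ forall Q, ETheta M Q ->
            unique (fun q => ES (xlab b D M) q /\ intertwines (xlab b D) M Q q)
              (Dbar Q),
          forall Q, ETheta M Q ->
            unique (fun q => ES (xplus b D M) q /\ intertwines (xplus b D) M Q q)
              (Dbar_plus Q),
          Dbar U = u
        & Dbar_plus U = u_plus],
      (* (b) *)
      (forall q, ES (xlab b D M) q -> q <> u ->
         exists! tQ : int * {ptws Theta M -> Theta M},
           ETheta M tQ.2 /\ q = S_on (xlab b D M) tQ.1 \o Dbar tQ.2) /\
      (forall q, ES (xplus b D M) q -> q <> u_plus ->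
         exists! tQ : int * {ptws Theta M -> Theta M},
           ETheta M tQ.2 /\ q = S_on (xplus b D M) tQ.1 \o Dbar_plus tQ.2)
    & (* (c) *)
      [/\ forall r : Nvec,
            ES (xlab b D M) (Dbar (P_on M r)) /\
            continuous (Dbar (P_on M r)),
          forall r : Nvec,
            ES (xplus b D M) (Dbar_plus (P_on M r)) /\
            continuous (Dbar_plus (P_on M r)),
          continuous_action (fun r => Dbar (P_on M r))
        & continuous_action (fun r => Dbar_plus (P_on M r))]].
Proof.
rewrite (xlabE b_ge5 D_part) (xplusE b_ge5 D_part).
have s0 : signed_digit 0 by [].
have s1 : signed_digit 1 by [].
have sd c : signed_digit c -> `|c| <= 1 by [].
have p0 : binary_digit 0 by [].
have p1 : binary_digit 1 by [].
have pd c : binary_digit c -> `|c| <= 1 by exact: binary_digit_signed.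
(* The constant map is itself a translation, by any vector outside of [M]. *)
have [r rM] := P_eq_label0 M_fin.
have U0 (N : Theta M) : val (P_on M r N) = label0.
  exact: rM (set_mem (valP N)).
have UE : ETheta M (P_on M r) by exact: ETheta_P.
pose Ds := config_map b_ge5 D_part s0 s1 sd M_fin.
pose Dp := config_map b_ge5 D_part p0 p1 pd M_fin.
exists (P_on M r), (Ds (P_on M r)), (Dp (P_on M r)), Ds, Dp.
split.
- split; first by split.
  + by split; [exact: config_map_ES|exact: config_mapU_idem|
               exact: val_config_mapU].
  + by split; [exact: config_map_ES|exact: config_mapU_idem|
               exact: val_config_mapU].
- by split=> // Q QE; exact: config_map_unique.
- by split=> q; exact: shifted_config_map_exists_unique.
- split=> [r'|r'||]; try exact: config_map_P_action.
  + by split; [exact/config_map_ES/ETheta_P|exact: config_map_P_continuous].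
  + by split; [exact/config_map_ES/ETheta_P|exact: config_map_P_continuous].
Qed.
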